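(* There exist universal constants $C,\widetilde{C},\gamma>0$ with the following property: for any $d\in\mathbb{N}$, any quasi-normed space $\mathcal{F}\hookrightarrow L^\infty(\mathbb{T}^d)$, and arbitrary $n,M\in\mathbb{N}$ with $M\ge3$, we have $$\varrho_{\lceil Cd\log(d+1)\,n\log(n+1)^2\log(M)\rceil}(\mathcal{F})_{L^2(\mathbb{T}^d)}\le\widetilde{C}\Big(\sigma_n(\mathcal{F};\mathcal{T}^d)_{L^\infty(\mathbb{T}^d)}+E_{[-M,M]^d\cap\mathbb{Z}^d}(\mathcal{F};\mathcal{T}^d)_{L^\infty(\mathbb{T}^d)}\Big).$$ In fact, put $$m:=\lceil C\cdot d\cdot\log(d+1)\cdot n\cdot\log(n+1)^2\cdot\log(M)\rceil,\qquad N:=(2(2d+1)M+1)^d,\qquad D:=(2d+1)M,$$ and let $u_1,\ldots,u_m$ be drawn independently and identically distributed from the uniform measure on the grid $\frac{1}{2D+1}\{0,\ldots,2D\}^d$ (viewed as a subset of $\mathbb{T}^d$). Then with probability at least $1-N^{-\gamma\log(n+1)}$ with respect to the choice of $u_1,\ldots,u_m$, the reconstruction operator $R_\eta$ (built from the points $u_1,\ldots,u_m$ as described in the context) satisfies $$\|f-R_\eta(f(u_1),\ldots,f(u_m))\|_{L^2(\mathbb{T}^d)}\le\widetilde{C}\Big(\sigma_n(\mathcal{F};\mathcal{T}^d)_{L^\infty(\mathbb{T}^d)}+E_{[-M,M]^d\cap\mathbb{Z}^d}(\mathcal{F};\mathcal{T}^d)_{L^\infty(\mathbb{T}^d)}\Big)$$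 for all $f\in\mathcal{F}$ with $\|f\|_{\mathcal{F}}\le1$.
   Context: $\mathbb{T}^d=\mathbb{R}^d/\mathbb{Z}^d\cong[0,1)^d$ carries the normalized Haar measure $\mu$, and $L^2(\mathbb{T}^d)=L^2(\mu)$. $L^\infty(\mathbb{T}^d)$ is the space of all bounded measurable functions $f:\mathbb{T}^d\to\mathbb{C}$ (no a.e. identification) with the supremum norm. $\mathcal{F}\hookrightarrow L^\infty(\mathbb{T}^d)$ means $\mathcal{F}$ is a quasi-normed space of functions on $\mathbb{T}^d$ continuously embedded into $L^\infty(\mathbb{T}^d)$. $\mathcal{T}^d=(e_k)_{k\in\mathbb{Z}^d}$ with $e_k=\mathrm{e}^{2\pi\mathrm{i}\langle k,\cdot\rangle}$ and $\widehat f(k)=\langle f,e_k\rangle_{L^2(\mathbb{T}^d)}$. $\log$ is the natural logarithm. $\sigma_n(\mathcal{F};\mathcal{T}^d)_{L^\infty(\mathbb{T}^d)}=\sup_{\|f\|_{\mathcal{F}}\le1}\inf\{\|f-\sum_{k\in J}c_ke_k\|_{L^\infty(\mathbb{T}^d)}:J\subset\mathbb{Z}^d,|J|\le n,(c_k)\in\mathbb{C}^J\}$, and for $J\subset\mathbb{Z}^d$, $E_J(\mathcal{F};\mathcal{T}^d)_{L^\infty(\mathbb{T}^d)}=\sup_{\|f\|_{\mathcal{F}}\le1}\inf\{\|f-g\|_{L^\infty(\mathbb{T}^d)}:g\in\mathrm{span}\{e_k:k\in J\}\}$. Sampling numbers: $\varrho_m(\mathcal{F})_X=\inf_{t_1,\ldots,t_m\in\mathbb{T}^d}\inf_{R:\mathbb{C}^m\to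 X}\sup_{\|f\|_{\mathcal{F}}\le1}\|f-R(f(t_1),\ldots,f(t_m))\|_X$, with $R$ ranging over all (not necessarily linear) maps. De la Vallée Poussin operator: for integers $0\le b\le a$ and $k\in\mathbb{Z}$ let $a_k^{(a,b)}=1$ if $|k|\le a-b$, $a_k^{(a,b)}=\frac{a+b+1-|k|}{2b+1}$ if $a-b+1\le|k|\le a+b$, and $a_k^{(a,b)}=0$ otherwise. Set $\mathcal{P}_M^df=\sum_{k\in\mathbb{Z}^d}\big(\prod_{i=1}^da_{k_i}^{((d+1)M,dM)}\big)\widehat f(k)e_k$ and $\tau=\|\mathcal{P}_M^d\|_{L^\infty(\mathbb{T}^d)\to L^\infty(\mathbb{T}^d)}$. Reconstruction operator: let $J^\ast=\{k\in\mathbb{Z}^d:\|k\|_{\ell^\infty}\le(2d+1)M\}$ (so $|J^\ast|=N$) and $$\eta=\tau\,\sigma_n(\mathcal{F};\mathcal{T}^d)_{L^\infty(\mathbb{T}^d)}+(1+\tau)\,E_{[-M,M]^d\cap\mathbb{Z}^d}(\mathcal{F};\mathcal{T}^d)_{L^\infty(\mathbb{T}^d)}.$$ Put $A=(e_k(u_\ell))_{\ell\in\{1,\ldots,m\},k\in J^\ast}$. For $y\in\mathbb{C}^m$ let $x^\#(y)\in\mathbb{C}^{J^\ast}$ be any (fixed) solution of minimizing $\|z\|_{\ell^1(J^\ast)}$ over $z\in\mathbb{C}^{J^\ast}$ subject to $\|Az-y\|_{\ell^2(m)}\le\eta\sqrt m$ if one exists, and $x^\#(y)=0$ otherwise. Then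 $R_\eta(y)=\sum_{k\in J^\ast}(x^\#(y))_ke_k$. *)

(* Defs.v *)
From HB Require Import structures.
From mathcomp Require Import all_boot all_order all_algebra finmap complex.
From mathcomp Require Import all_classical all_reals all_analysis.

Set Implicit Arguments.
Unset Strict Implicit.
Unset Printing Implicit Defensive.

Import Order.TTheory GRing.Theory Num.Theory.
Import numFieldNormedType.Exports.

Local Open Scope classical_set_scope.
Local Open Scope ring_scope.

Notation cabs := ComplexField.Normc.normc.

(* R/Z is represented by its fundamental domain [0,1), and T^d by d.-tuple's
   over it, which carry the product sigma-algebra of the library. *)
Record circle (R : realType) := Circle {
  cval : R ;
  cvalP : (0 <= cval) && (cval < 1) }.

HB.instance Definition _ (R : realType) := [isSub for @cval R].
HB.instance Definition _ (R : realType) := [Choice of circle R by <:].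

Lemma circle0_subproof (R : realType) : (0 <= 0 :> R) && (0 < 1 :> R).
Proof. by rewrite lexx ltr01. Qed.

HB.instance Definition _ (R : realType) :=
  isPointed.Build (circle R) (Circle (circle0_subproof R)).

Definition circle_display : measure_display.
Proof. exact: default_measure_display. Qed.

Section circle_measurable.
Variable R : realType.

Definition circle_measurable : set (set (circle R)) :=
  preimage_set_system [set: circle R] (@cval R) measurable.

Let circle_sigma_algebra : sigma_algebra setT circle_measurable.
Proof. exact/sigma_algebra_preimage/sigma_algebra_measurable. Qed.

Let circle_measurable0 : circle_measurable set0.
Proof. by case: circle_sigma_algebra. Qed.

Let circle_measurableC A : circle_measurable A -> circle_measurable (~` A).
Proof. by case: circle_sigma_algebra => _ + _; rewrite -setTD; apply. Qed.

Let circle_measurable_bigcup (F : (set (circle R))^nat) :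
  (forall i, circle_measurable (F i)) ->
  circle_measurable (\bigcup_i F i).
Proof. by case: circle_sigma_algebra => _ _; apply. Qed.

HB.instance Definition _ := @isMeasurable.Build circle_display (circle R)
  circle_measurable circle_measurable0 circle_measurableC
  circle_measurable_bigcup.

End circle_measurable.

Section circle_haar.
Variable R : realType.

Definition circle_haar (A : set (circle R)) : \bar R :=
  lebesgue_measure (@cval R @` A).

Lemma cval_inj : injective (@cval R).
Proof. exact: val_inj. Qed.

Lemma image_cval_preimage (B : set R) :
  @cval R @` (@cval R @^-1` B) = `[0, 1[ `&` B.
Proof.
apply/seteqP; split => [_ [x Bx <-]|x [/=]].
  by split=> //=; rewrite in_itv /=; exact: cvalP.
by rewrite in_itv /= => x01 Bx; exists (Circle x01).
Qed.

Lemma measurable_image_cval (A : set (circle R)) :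
  measurable A -> measurable (@cval R @` A).
Proof.
case=> B mB <-; rewrite setTI image_cval_preimage.
by apply: measurableI.
Qed.

Let circle_haar0 : circle_haar set0 = 0%E.
Proof. by rewrite /circle_haar image_set0 measure0. Qed.

Let circle_haar_ge0 A : (0 <= circle_haar A)%E.
Proof. exact: measure_ge0. Qed.

Let circle_haar_sigma_additive : semi_sigma_additive circle_haar.
Proof.
move=> F mF tF mUF; rewrite /circle_haar image_bigcup.
apply: measure_semi_sigma_additive.
- by move=> i; exact: measurable_image_cval.
- move=> i j _ _ [_ [[x Fix <-] [y Fjy /cval_inj yx]]].
  by apply: (tF i j I I); exists x; split=> //; rewrite -yx.
- by apply: bigcup_measurable => i _; exact: measurable_image_cval.
Qed.

HB.instance Definition _ := isMeasure.Build _ _ _ circle_haar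
  circle_haar0 circle_haar_ge0 circle_haar_sigma_additive.

Let circle_haar_setT : circle_haar setT = 1%E.
Proof.
rewrite /circle_haar -(preimage_setT (@cval R)) image_cval_preimage setIT.
by rewrite lebesgue_measure_itv /= lte_fin ltr01 sube0.
Qed.

HB.instance Definition _ :=
  Measure_isProbability.Build _ _ _ circle_haar circle_haar_setT.

End circle_haar.

Notation torus R d := (d.-tuple (circle R)).

Section torus.
Variable R : realType.

Definition torus_cons (d : nat) (x : circle R * torus R d) : torus R d.+1 :=
  [the d.+1.-tuple (circle R) of x.1 :: x.2].

Lemma measurable_torus_cons d : measurable_fun setT (@torus_cons d).
Proof. by apply: measurable_cons. Qed.

HB.instance Definition _ d := @isMeasurableFun.Build _ _ _ _
  (@torus_cons d) (@measurable_torus_cons d).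

(* The d-fold product of circle_haar: the library has no n-ary product measure
   on tuples, so it is iterated along circle * torus d = torus d.+1. *)
Fixpoint haar (d : nat) : probability (torus R d) R :=
  match d with
  | 0 => \d_ [tuple]
  | d'.+1 => distribution (@circle_haar R \x haar d')%E (@torus_cons d')
  end.

End torus.

Section function_spaces.
Variable R : realType.

Definition cmeasurable disp (T : measurableType disp) (f : T -> R[i]) : Prop :=
  measurable_fun setT (fun x => complex.Re (f x)) /\
  measurable_fun setT (fun x => complex.Im (f x)).

Definition cintegral disp (T : measurableType disp)
    (mu : {measure set T -> \bar R}) (f : T -> R[i]) : R[i] :=
  Complex (\int[mu]_x complex.Re (f x)) (\int[mu]_x complex.Im (f x)).

Definition sup_norm (T : Type) (f : T -> R[i]) : \bar R :=
  ereal_sup [set (cabs (f x))%:E | x in setT].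

Definition Linfty disp (T : measurableType disp) : set (T -> R[i]) :=
  [set f | cmeasurable f /\ exists B : R, forall x, cabs (f x) <= B].

Definition L2norm d (f : torus R d -> R[i]) : \bar R :=
  Lnorm (haar R d) 2%:E (fun x => (cabs (f x))%:E).

Definition L2 d : set (torus R d -> R[i]) :=
  [set f | cmeasurable f /\ (L2norm f < +oo)%E].

(* A quasi-normed space of complex-valued functions on T, as a linear subspace
   of the functions (no identification of functions equal a.e.); qnorm is
   meaningful on qcarrier only. *)
Record quasiNormedSpace (T : Type) := QuasiNormedSpace {
  qcarrier : set (T -> R[i]) ;
  qnorm : (T -> R[i]) -> R ;
  qcarrier0 : qcarrier (fun=> 0) ;
  qcarrierD : forall f g, qcarrier f -> qcarrier g ->
    qcarrier (fun x => f x + g x) ;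
  qcarrierZ : forall (c : R[i]) f, qcarrier f -> qcarrier (fun x => c * f x) ;
  qnorm_ge0 : forall f, qcarrier f -> 0 <= qnorm f ;
  qnorm0_eq0 : forall f, qcarrier f -> qnorm f = 0 -> forall x, f x = 0 ;
  qnormZ : forall (c : R[i]) f, qcarrier f ->
    qnorm (fun x => c * f x) = cabs c * qnorm f ;
  qnormD : exists K : R, forall f g, qcarrier f -> qcarrier g ->
    qnorm (fun x => f x + g x) <= K * (qnorm f + qnorm g) }.

Definition unit_ball (T : Type) (F : quasiNormedSpace T) : set (T -> R[i]) :=
  [set f | qcarrier F f /\ qnorm F f <= 1].

(* Inclusion into L^oo, together with continuity of the inclusion map. *)
Definition embeds_in_Linfty disp (T : measurableType disp)
    (F : quasiNormedSpace T) : Prop :=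
  (forall f, qcarrier F f -> Linfty f) /\
  (forall f, qcarrier F f -> forall eps : R, 0 < eps -> exists2 delta : R, 0 < delta &
     forall g, qcarrier F g -> qnorm F (fun x => g x - f x) < delta ->
       (sup_norm (fun x => g x - f x)%R < eps%:E)%E).

End function_spaces.

Arguments Linfty {R disp} T _.
Arguments L2 {R} d _.

Notation freq d := {ffun 'I_d -> int}.

Section approximation.
Variables (R : realType) (d : nat).
Implicit Types (F : quasiNormedSpace R (torus R d)) (J : set (freq d)).

(* e_k(x) = exp(2 pi i <k, x>), as cos + i sin. *)
Definition expk (k : freq d) (x : torus R d) : R[i] :=
  let t : R := 2 * pi * \sum_(i < d) (k i)%:~R * cval (tnth x i) in
  Complex (cos t) (sin t).

Definition fourier (f : torus R d -> R[i]) (k : freq d) : R[i] :=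
  cintegral (haar R d) (fun x => f x * conjc (expk k x)).

Definition trigo_poly (A : {fset freq d}) (c : freq d -> R[i]) :
  torus R d -> R[i] := fun x => \sum_(k <- A) c k * expk k x.

(* sigma_n(F; T^d)_{L^oo} *)
Definition best_nterm (n : nat) F : \bar R :=
  ereal_sup [set ereal_inf [set sup_norm (fun x => f x - trigo_poly A c x) |
      A in [set A : {fset freq d} | (#|` A| <= n)%N] & c in setT] |
    f in unit_ball F].

Definition trigo_span J : set (torus R d -> R[i]) :=
  [set trigo_poly A c | A in [set A : {fset freq d} | [set` A] `<=` J] &
     c in setT].

(* E_J(F; T^d)_{L^oo} *)
Definition best_approx J F : \bar R :=
  ereal_sup [set ereal_inf [set sup_norm (fun x => f x - g x) |
      g in trigo_span J] |
    f in unit_ball F].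

Definition cube (M : nat) : set (freq d) :=
  [set k | forall i, (`|k i| <= M)%N].

Definition samples m (t : 'I_m -> torus R d) (f : torus R d -> R[i]) :
  'I_m -> R[i] := fun l => f (t l).

Definition sampling_number (m : nat) F : \bar R :=
  ereal_inf [set ereal_sup [set L2norm (fun x => f x - rec (samples t f) x) |
      f in unit_ball F] |
    t in [set: 'I_m -> torus R d] &
    rec in [set rec : ('I_m -> R[i]) -> torus R d -> R[i] |
      forall y, L2 d (rec y)]].

(* De la Vallee Poussin weights a_k^(a,b); only meant for b <= a, since
   a - b is truncated. *)
Definition vp_coef (a b : nat) (k : int) : R :=
  if (`|k| <= a - b)%N then 1
  else if (`|k| <= a + b)%N
  then ((a + b + 1)%:R - `|k|%N%:R) / (2 * b + 1)%:R
  else 0.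

Definition vp_operator (M : nat) (f : torus R d -> R[i]) :
    torus R d -> R[i] := fun x =>
  \sum_(k \in [set: freq d])
    (\prod_(i < d) vp_coef (d.+1 * M) (d * M) (k i))%:C%C *
    fourier f k * expk k x.

(* tau, the operator norm of vp_operator on L^oo *)
Definition vp_norm (M : nat) : \bar R :=
  ereal_sup [set sup_norm (vp_operator M f) |
    f in [set f | Linfty (torus R d) f /\ (sup_norm f <= 1)%E]].

(* eta *)
Definition noise_level (n M : nat) F : \bar R :=
  (vp_norm M * best_nterm n F + (1 + vp_norm M) * best_approx (cube M) F)%E.

(* A vector of C^J is represented by a function on all frequencies, of which
   only the restriction to J matters. *)
Definition feasible m (u : 'I_m -> torus R d) J (eps : \bar R)
    (y : 'I_m -> R[i]) (z : freq d -> R[i]) : Prop :=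
  ((Num.sqrt (\sum_(l < m)
      cabs (\sum_(k \in J) expk k (u l) * z k - y l) ^+ 2))%:E <= eps)%E.

Definition l1norm J (z : freq d -> R[i]) : R := \sum_(k \in J) cabs (z k).

Definition l1_minimizer m (u : 'I_m -> torus R d) J (eps : \bar R)
    (y : 'I_m -> R[i]) (z : freq d -> R[i]) : Prop :=
  feasible u J eps y z /\
  forall z', feasible u J eps y z' -> l1norm J z <= l1norm J z'.

(* xs selects, for each y, some solution of the constrained l1-minimization
   problem if there is one, and the zero vector otherwise. *)
Definition l1_minimization_map m (u : 'I_m -> torus R d) J (eps : \bar R)
    (xs : ('I_m -> R[i]) -> freq d -> R[i]) : Prop :=
  forall y,
    ((exists z, l1_minimizer u J eps y z) -> l1_minimizer u J eps y (xs y)) /\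
    (~ (exists z, l1_minimizer u J eps y z) -> forall k, J k -> xs y k = 0).

Definition reconstruction m J (xs : ('I_m -> R[i]) -> freq d -> R[i])
    (y : 'I_m -> R[i]) : torus R d -> R[i] :=
  fun x => \sum_(k \in J) xs y k * expk k x.

End approximation.

Arguments cube d M _ : clear implicits.

Section random_grid_points.
Variables (R : realType) (d : nat).

Lemma grid_subproof (D : nat) (j : 'I_(2 * D + 1)) :
  (0 <= j%:R / (2 * D + 1)%:R :> R) && (j%:R / (2 * D + 1)%:R < 1 :> R).
Proof.
by rewrite divr_ge0 ?ler0n//= ltr_pdivrMr ?mul1r ?ltr_nat ?ltr0n ?addn1.
Qed.

Definition grid_point (D : nat) (g : {ffun 'I_d -> 'I_(2 * D + 1)}) :
  torus R d := [tuple Circle (grid_subproof (g i)) | i < d].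

End random_grid_points.

Definition iid_uniform (R : realType) disp (Omega : measurableType disp)
    (P : probability Omega R) (G : finType) (m : nat)
    (U : 'I_m -> Omega -> G) : Prop :=
  [/\ forall l g, measurable (U l @^-1` [set g]),
      forall l g, P (U l @^-1` [set g]) = (#|G|%:R^-1)%:E &
      forall (L : {set 'I_m}) (B : 'I_m -> set G),
        P (\bigcap_(l in [set` L]) U l @^-1` B l) =
        (\prod_(l in L) P (U l @^-1` B l))%E ].

(* Main.v *)
Require Import Defs.
From HB Require Import structures.
From mathcomp Require Import all_boot all_order all_algebra finmap complex.
From mathcomp Require Import all_classical all_reals all_analysis measurable_realfun.
From mathcomp Require Import ring lra zify.

Set Implicit Arguments.
Unset Strict Implicit.
Unset Printing Implicit Defensive.

Import Order.TTheory GRing.Theory Num.Theory.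
Import numFieldNormedType.Exports.

Local Open Scope classical_set_scope.
Local Open Scope ring_scope.


(* With h := x# - x, where x is an exactly feasible n-sparse vector, the problem
   reduces to a restricted eigenvalue bound: ||h||_2^2 is at most a constant
   times the empirical mean of |sum_k h_k e_k|^2 over the samples whenever
   ||h||_1 <= 2 sqrt(n) ||h||_2. Only a lower bound is needed, so after
   normalising ||h||_1 = 1 one cuts |sum_k h_k e_k| into O(log n) dyadic layers
   theta = 2^-i. At each layer the function is approximated, outside a set that
   is negligible for the uniform and for the empirical measure simultaneously,
   by an average of O(4^i log n) atoms +-2 e_k, +-2i e_k (Maurey); the level sets
   of these averages form a family of cardinality N^O(4^i log n), over which a
   Chernoff lower tail and a union bound cost
   O(n log(n+1)^2 log N) samples and fail with probability at most
   N^(-log(n+1)). The de la Vallee Poussin operator, of norm at most 5/2, turns a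
   near-best n-term approximation into an n-sparse vector supported in J*. *)

(** * Empirical approximation and Chernoff bounds *)

(** Two obstacles shape the argument. The radius eta is sharp, while sigma_n and E are suprema of
    infima, so an n-sparse vector is a priori feasible only up to an arbitrary delta. Compactness
    over each of the finitely many supports produces an exactly feasible one, but that vector is
    controlled at the samples only. A second sparse vector, uniformly within eta + delta of f, leads
    back to f: its difference from the first is 2n-sparse, hence obeys the same restricted
    eigenvalue bound, and delta is finally sent to 0. The two logarithms of n come from the layers.
    Layer i carries the weight 4^-i in the energy, so its Chernoff slack may grow like 4^i, as does
    the entropy of the averages used there; every layer then asks for the same number of samples.
    With T of order log n layers, one factor T is the length that makes the exceptional sets small
    enough, and the other comes from sharing the total slack 1/(32 n) among the layers. The grid
    makes the exponentials of J* exactly orthonormal for a uniform measure on a finite set, so all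
    probabilities become counts. *)

Section greedy.
Variable R : realType.

(** From exp(-x) >= 1 - x and (1 - x)(1 + x + 2 x^2) = 1 + x^2 (1 - 2 x). Very negative x are
    allowed. *)
Lemma expR_le_quad (x : R) : x <= 2^-1 -> expR x <= 1 + x + 2 * x ^+ 2.
Proof.
move=> x2; have x1 : 0 < 1 - x by lra.
rewrite -[x in expR x]opprK expRN.
apply: (@le_trans _ _ (1 - x)^-1).
  by rewrite lef_pV2 ?posrE ?expR_gt0//; exact: expR_ge1Dx.
rewrite -div1r ler_pdivrMr//.
have : 0 <= x ^+ 2 * (1 - 2 * x) by rewrite mulr_ge0 ?sqr_ge0//; lra.
lra.
Qed.

Lemma expR_half_le2 : expR (2^-1) <= 2 :> R.
Proof. by have := @expR_le_quad 2^-1; lra. Qed.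

Lemma expR1_le4 : expR 1 <= 4 :> R.
Proof.
rewrite [X in expR X](_ : 1 = 2^-1 + 2^-1); last by field.
rewrite expRD (_ : 4 = 2 * 2); last by ring.
by rewrite ler_pM ?expR_ge0 ?expR_half_le2.
Qed.

Lemma weighted_pigeonhole (K : finType) (w g : K -> R) (B : R) :
  (forall k, 0 <= w k) -> \sum_k w k = 1 -> \sum_k w k * g k <= B ->
  exists k, g k <= B.
Proof.
move=> w0 w1 wB; apply/not_existsP => gB.
have {}gB k : 0 < g k - B by rewrite subr_gt0 ltNge; apply/negP/gB.
have s0 : \sum_k w k * (g k - B) = 0.
  apply/eqP; rewrite eq_le; apply/andP; split; last first.
    by apply: sumr_ge0 => k _; rewrite mulr_ge0// ltW.
  under eq_bigr do rewrite mulrBr.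
  by rewrite sumrB -mulr_suml w1 mul1r subr_le0.
have wk0 k : w k = 0.
  have /eqP : w k * (g k - B) = 0.
    by apply: (psumr_eq0P _ s0) => // j _; rewrite mulr_ge0// ltW.
  by rewrite mulf_eq0 (gt_eqF (gB k)) orbF => /eqP.
by move: w1; rewrite big1// => /esym/eqP; rewrite oner_eq0.
Qed.

(* Maurey's empirical method, derandomised: the atoms are chosen one at a time
   so that the exponential moment of the deviation never exceeds its mean. *)
Lemma greedy_exp_moment (K Y : finType) (w : K -> R) (nu f : Y -> R)
    (phi : K -> Y -> R) (b lam : R) (s : nat) :
  (forall k, 0 <= w k) -> \sum_k w k = 1 -> (forall y, 0 <= nu y) ->
  (forall k y, `|phi k y| <= b) -> (forall y, f y = \sum_k w k * phi k y) ->
  0 <= lam -> lam * b <= 4^-1 ->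
  exists c : s.-tuple K,
    \sum_y nu y * expR (lam * (\sum_(k <- c) phi k y - s%:R * f y)) <=
    (\sum_y nu y) * expR (8 * lam ^+ 2 * b ^+ 2 * s%:R).
Proof.
move=> w0 w1 nu0 phib fE lam0 lamb.
have fb y : `|f y| <= b.
  rewrite fE (le_trans (ler_norm_sum _ _ _))// -[leRHS]mul1r -w1 mulr_suml.
  by apply: ler_sum => k _; rewrite normrM ger0_norm// ler_wpM2l.
(* The exponent is at most 2 lam b <= 1/2, so the quadratic bound applies; its linear term averages
   to zero because [f y] is the mean, and its square is at most 4 b^2 lam^2, whence 8 = 2 * 4. *)
have avg y : \sum_k w k * expR (lam * (phi k y - f y)) <=
    expR (8 * lam ^+ 2 * b ^+ 2).
  apply: (@le_trans _ _ (1 + 8 * lam ^+ 2 * b ^+ 2)); last exact: expR_ge1Dx.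
  apply: (@le_trans _ _ (\sum_k (w k * (1 + 8 * lam ^+ 2 * b ^+ 2 - lam * f y)
    + lam * (w k * phi k y)))).
    apply: ler_sum => k _.
    have /ler_normlP[p1 p2] := phib k y; have /ler_normlP[f1 f2] := fb y.
    have p3 : lam * (phi k y - f y) <= 2 * (lam * b).
      rewrite mulrCA ler_wpM2l//; lra.
    have -> : w k * (1 + 8 * lam ^+ 2 * b ^+ 2 - lam * f y) +
      lam * (w k * phi k y) =
      w k * (1 + lam * (phi k y - f y) + 8 * lam ^+ 2 * b ^+ 2) by ring.
    apply: ler_wpM2l => //; apply: le_trans (expR_le_quad _) _; first lra.
    rewrite lerD2l exprMn.
    have : (phi k y - f y) ^+ 2 <= 4 * b ^+ 2.
      rewrite -subr_ge0.
      have -> : 4 * b ^+ 2 - (phi k y - f y) ^+ 2 =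
        (2 * b - (phi k y - f y)) * (2 * b + (phi k y - f y)) by ring.
      by rewrite mulr_ge0//; lra.
    move=> /(ler_wpM2l (sqr_ge0 lam)); lra.
  rewrite big_split/= -mulr_suml w1 -mulr_sumr -fE; lra.
elim: s => [|s [c IH]].
  exists [tuple]; rewrite mulr0 expR0 mulr1 ler_sum// => y _.
  by rewrite big_nil mul0r subr0 mulr0 expR0 mulr1.
set S := \sum_y nu y * _ in IH.
(* Averaged over the next atom, the moment grows by at most the factor of [avg]; some atom does no
   worse than the average. *)
have [] := @weighted_pigeonhole K w (fun k => \sum_y nu y *
    expR (lam * (\sum_(k <- c) phi k y - s%:R * f y)) *
    expR (lam * (phi k y - f y))) (S * expR (8 * lam ^+ 2 * b ^+ 2)) w0 w1.
  under eq_bigr do rewrite mulr_sumr.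
  rewrite exchange_big/= /S mulr_suml ler_sum// => y _.
  under eq_bigr do rewrite mulrCA.
  by rewrite -mulr_sumr ler_wpM2l// mulr_ge0// expR_ge0.
move=> k kS; exists [tuple of k :: c].
have -> : expR (8 * lam ^+ 2 * b ^+ 2 * s.+1%:R) =
    expR (8 * lam ^+ 2 * b ^+ 2 * s%:R) * expR (8 * lam ^+ 2 * b ^+ 2).
  by rewrite -expRD -[s.+1]addn1 natrD mulrDr mulr1.
rewrite mulrA; apply: le_trans (_ : _ <= S * expR (8 * lam ^+ 2 * b ^+ 2)) _.
  apply: le_trans kS; rewrite le_eqVlt; apply/orP; left; apply/eqP.
  apply: eq_bigr => y _; rewrite -mulrA -expRD -mulrDr big_cons.
  by congr (_ * expR (_ * _)); rewrite -[s.+1]addn1 natrD; ring.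
by rewrite ler_wpM2r ?expR_ge0.
Qed.

Lemma sum_ffun_prod (X : finType) (m : nat) (g : X -> R) :
  \sum_(u : {ffun 'I_m -> X}) \prod_l g (u l) = (\sum_x g x) ^+ m.
Proof.
by rewrite -(bigA_distr_bigA (fun _ : 'I_m => g)) prodr_const card_ord.
Qed.

(** The additive slack makes the bound independent of the density p of [B]: if p <= a the threshold
    is nonpositive and no sample is bad; otherwise the usual tail exp(-m p / 32) is at most exp(-m a
    / 32). *)
Lemma chernoff_lower (X : finType) (B : pred X) (m : nat) (a : R) :
  0 <= a -> 
  #|[pred u : {ffun 'I_m -> X} | #|[pred l | B (u l)]|%:R / m%:R <
       (#|B|%:R / #|X|%:R) / 2 - a / 2 :> R]|%:R <=
  expR (- (m%:R * a / 32)) * #|X|%:R ^+ m :> R.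
Proof.
move=> a0; set p : R := #|B|%:R / #|X|%:R.
set bad := [pred u | _].
have [pa|pa] := lerP p a.
  rewrite (@eq_card0 _ bad); last first.
    move=> u; rewrite !inE; apply/negbTE; rewrite -leNgt.
    apply: (@le_trans _ _ 0); first lra.
    by rewrite divr_ge0.
  by rewrite mulr_ge0 ?expR_ge0// exprn_ge0.
have X0 : 0 < #|X|%:R :> R.
  rewrite ltr0n lt0n; apply/negP => /eqP X0.
  by move: pa; rewrite /p X0 invr0 mulr0 ltNge a0.
have [m0|m0] := posnP m.
  rewrite [X in expR (- (X%:R * _ / _))]m0 !mul0r oppr0 expR0 mul1r -natrX ler_nat.
  by rewrite (leq_trans (max_card _))// card_ffun card_ord.
have m0' : 0 < m%:R :> R by rewrite ltr0n.
(* Exponential Markov with parameter 1/8: on a bad sample m p / 16 minus an eighth of the count is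
   nonnegative. As 1 - exp(-1/8) >= 3/32, the final exponent is m p (1/16 - 3/32) = - m p / 32. *)
pose g (x : X) : R := expR (- (8^-1 * (B x)%:R)).
apply: (@le_trans _ _ (\sum_(u : {ffun 'I_m -> X})
    expR (m%:R * p / 16) * \prod_l g (u l))).
  rewrite -sumr_const -[leLHS]addr0 [leRHS](bigID (mem bad))/= lerD//; last first.
    apply: sumr_ge0 => u _; rewrite mulr_ge0 ?expR_ge0// prodr_ge0// => l _.
    exact: expR_ge0.
  apply: ler_sum => u; rewrite inE => ub.
  rewrite -expR_sum -expRD -[leLHS]expR0 ler_expR.
  rewrite sumrN -mulr_sumr -natr_sum.
  have -> : (\sum_(i < m) B (u i) = #|[pred l | B (u l)]|)%N.
    by rewrite -sum1_card [RHS]big_mkcond; apply: eq_bigr => l _; rewrite inE; case: (B (u l)).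
  move: ub; rewrite ltr_pdivrMr// => ub.
  have : 0 <= m%:R * a by rewrite mulr_ge0// ltW.
  move: (_%:R) ub => c ub; clear g m0 bad u X0; clearbody p; lra.
rewrite -mulr_sumr sum_ffun_prod.
have gX : \sum_x g x <= expR (- (3 / 32 * p)) * #|X|%:R.
  have -> : \sum_x g x = #|X|%:R * (1 - (1 - expR (- 8^-1)) * p).
    rewrite (eq_bigr (fun x => 1 - (1 - expR (- 8^-1)) * (B x)%:R)); last first.
      move=> x _; rewrite /g; case: (B x); rewrite ?mulr1 ?mulr0 ?oppr0 ?expR0; lra.
    rewrite sumrB sumr_const -mulr_sumr -natr_sum.
    have -> : (\sum_(i : X) B i = #|B|)%N.
      by rewrite -sum1_card [RHS]big_mkcond; apply: eq_bigr => l _; rewrite unfold_in; case: (B l).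
    by rewrite /p; field; rewrite lt0r_neq0.
  rewrite mulrC ler_wpM2r//.
  have /ltW p0 : 0 < p by exact: le_lt_trans pa.
  apply: le_trans (_ : 1 - 3 / 32 * p <= _); last exact: expR_ge1Dx.
  rewrite lerD2l lerN2 ler_wpM2r//.
  have := @expR_le_quad (- 8^-1); lra.
have g0 : 0 <= \sum_x g x by apply: sumr_ge0 => x _; exact: expR_ge0.
apply: (@le_trans _ _ (expR (m%:R * p / 16) *
   (expR (- (3 / 32 * p)) * #|X|%:R) ^+ m)).
  by rewrite ler_wpM2l ?expR_ge0// lerXn2r// nnegrE// (le_trans g0).
rewrite exprMn mulrA ler_wpM2r ?exprn_ge0//.
rewrite -expRM_natl -expRD ler_expR.
have : 0 <= m%:R * (p - a) by rewrite mulr_ge0// ?ltW// subr_gt0.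
lra.
Qed.

End greedy.



(** * Real and imaginary parts, and the complex modulus *)

Section complex_modulus.
Variable R : realType.
Implicit Types z w : R[i].

Lemma cReD z w : complex.Re (z + w) = complex.Re z + complex.Re w.
Proof. by case: z w => [a b] [c d]. Qed.

Lemma cImD z w : complex.Im (z + w) = complex.Im z + complex.Im w.
Proof. by case: z w => [a b] [c d]. Qed.

Lemma cReN z : complex.Re (- z) = - complex.Re z.
Proof. by case: z. Qed.

Lemma cImN z : complex.Im (- z) = - complex.Im z.
Proof. by case: z. Qed.

Lemma cReM z w : complex.Re (z * w) =
  complex.Re z * complex.Re w - complex.Im z * complex.Im w.
Proof. by case: z w => [a b] [c d]. Qed.

Lemma cImM z w : complex.Im (z * w) =
  complex.Re z * complex.Im w + complex.Im z * complex.Re w.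
Proof. by case: z w => [a b] [c d]. Qed.

Lemma cRe_sum (I : Type) (r : seq I) (P : pred I) (F : I -> R[i]) :
  complex.Re (\sum_(i <- r | P i) F i) = \sum_(i <- r | P i) complex.Re (F i).
Proof. exact: (big_morph _ cReD). Qed.

Lemma cIm_sum (I : Type) (r : seq I) (P : pred I) (F : I -> R[i]) :
  complex.Im (\sum_(i <- r | P i) F i) = \sum_(i <- r | P i) complex.Im (F i).
Proof. exact: (big_morph _ cImD). Qed.

Lemma cabs_sqr z : cabs z ^+ 2 = complex.Re z ^+ 2 + complex.Im z ^+ 2.
Proof. by case: z => a b /=; rewrite sqr_sqrtr// addr_ge0// sqr_ge0. Qed.

Lemma cabs_ge0 z : 0 <= cabs z.
Proof. by case: z => a b /=; rewrite sqrtr_ge0. Qed.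

Lemma normr_Re_le z : `|complex.Re z| <= cabs z.
Proof.
rewrite -(ler_pXn2r (n := 2))// ?nnegrE// ?cabs_ge0//.
by rewrite real_normK ?num_real// cabs_sqr lerDl sqr_ge0.
Qed.

Lemma normr_Im_le z : `|complex.Im z| <= cabs z.
Proof.
rewrite -(ler_pXn2r (n := 2))// ?nnegrE// ?cabs_ge0//.
by rewrite real_normK ?num_real// cabs_sqr lerDr sqr_ge0.
Qed.

Lemma cabs_le_ReIm z : cabs z <= `|complex.Re z| + `|complex.Im z|.
Proof.
rewrite -(ler_pXn2r (n := 2))// ?nnegrE ?addr_ge0 ?cabs_ge0//.
rewrite cabs_sqr sqrrD !real_normK ?num_real//.
by rewrite lerD2r lerDl mulrn_wge0// mulr_ge0.
Qed.

Lemma cabsD z w : cabs (z + w) <= cabs z + cabs w.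
Proof. exact: le_normcD. Qed.

Lemma cabsN z : cabs (- z) = cabs z.
Proof. exact: normcN. Qed.

Lemma cabsB z w : cabs (z - w) = cabs (w - z).
Proof. by rewrite -cabsN opprB. Qed.

Lemma cabsM z w : cabs (z * w) = cabs z * cabs w.
Proof. exact: ComplexField.Normc.normcM. Qed.

Lemma cabs_real (r : R) : cabs r%:C%C = `|r|.
Proof. by rewrite /= expr0n/= addr0 sqrtr_sqr. Qed.

Lemma cabs0 : cabs (0 : R[i]) = 0.
Proof. exact: ComplexField.Normc.normc0. Qed.

Lemma cabs_sum (I : Type) (r : seq I) (P : pred I) (F : I -> R[i]) :
  cabs (\sum_(i <- r | P i) F i) <= \sum_(i <- r | P i) cabs (F i).
Proof.
elim/big_ind2 : _ => //; first by rewrite cabs0.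
by move=> x1 x2 y1 y2 h1 h2; rewrite (le_trans (cabsD _ _))// lerD.
Qed.

Lemma cabs_conj z : cabs (conjc z) = cabs z.
Proof. by case: z => a b /=; rewrite sqrrN. Qed.

Lemma mulc_conjE z : z * conjc z = (cabs z ^+ 2)%:C%C.
Proof.
apply/eqP; rewrite cabs_sqr eq_complex cReM cImM; case: z => a b /=.
by rewrite mulrN opprK -!expr2 eqxx/= mulrN mulrC addNr.
Qed.

End complex_modulus.

(** * Maurey's approximation of l1-bounded combinations by short averages *)

Section maurey.
Variables (R : realType) (X J : finType) (e : J -> X -> R[i]).
Hypothesis e_le1 : forall j x, cabs (e j x) <= 1.

Definition synthesis (h : J -> R[i]) (x : X) : R[i] := \sum_j h j * e j x.

Let dir : finType := (bool * bool)%type.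

(** The four functionals Re, -Re, Im, -Im: the first boolean selects the imaginary part, the second
    the sign. They turn a complex deviation into one-sided real ones. *)
Definition part (q : dir) (z : R[i]) : R :=
  (-1) ^+ q.2 * (if q.1 then complex.Im z else complex.Re z).

Definition phase (q : dir) : R[i] :=
  if q.1 then Complex 0 ((-1) ^+ q.2) else Complex ((-1) ^+ q.2) 0.

Lemma partD q z w : part q (z + w) = part q z + part q w.
Proof. by rewrite /part; case: q.1; rewrite ?cReD ?cImD mulrDr. Qed.

Lemma partN q z : part q (- z) = - part q z.
Proof. by rewrite /part; case: q.1; rewrite ?cReN ?cImN mulrN. Qed.

Lemma part_sum q (I : Type) (r : seq I) (F : I -> R[i]) :
  part q (\sum_(i <- r) F i) = \sum_(i <- r) part q (F i).
Proof.
apply: (big_morph _ (partD q)).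
by rewrite /part; case: q.1; rewrite mulr0.
Qed.

Lemma partZ q (r : R) z : part q (r%:C%C * z) = r * part q z.
Proof.
by rewrite /part; case: q.1; rewrite ?cReM ?cImM /= mul0r ?subr0 ?addr0 mulrCA.
Qed.

Lemma normr_part_le q z : `|part q z| <= cabs z.
Proof.
rewrite /part normrM normrX normrN1 expr1n mul1r.
by case: q.1; [exact: normr_Im_le|exact: normr_Re_le].
Qed.

Lemma sum_dir (V : nmodType) (F : dir -> V) : \sum_q F q =
  F (false, false) + F (false, true) + (F (true, false) + F (true, true)).
Proof.
rewrite (eq_bigr (fun q => F (q.1, q.2))); last by case.
rewrite -(pair_bigA _ (fun a b => F (a, b)))/= big_bool/= !big_bool/=.
by rewrite addrC; congr (_ + _); rewrite addrC.
Qed.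

Lemma pos_neg_parts (t : R) : Num.max 0 t - Num.max 0 (- t) = t /\
  Num.max 0 t + Num.max 0 (- t) = `|t|.
Proof.
have [t0|t0] := leP 0 t.
  by rewrite ger0_norm// max_l ?oppr_le0// subr0 addr0.
by rewrite ltr0_norm// max_r ?oppr_ge0 ?ltW// sub0r opprK add0r.
Qed.

Lemma sum_part_phase z :
  \sum_q (Num.max 0 (part q z))%:C%C * phase q = z.
Proof.
rewrite sum_dir /part /phase/=; case: z => a b /=.
rewrite expr0 expr1 !mul1r !mulN1r.
apply/eqP; rewrite eq_complex !(cReD, cImD, cReM, cImM)/=.
have [h1 _] := pos_neg_parts a; have [h2 _] := pos_neg_parts b.
by apply/andP; split; apply/eqP; [rewrite -[RHS]h1|rewrite -[RHS]h2];
  rewrite !(mulr0, mulr1, mulrN, mul0r, subr0, addr0, add0r, oppr0).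
Qed.

Lemma sum_part z : \sum_q Num.max 0 (part q z) <= 2 * cabs z.
Proof.
rewrite sum_dir /part /=.
rewrite expr0 expr1 !mul1r !mulN1r.
have [_ h1] := pos_neg_parts (complex.Re z).
have [_ h2] := pos_neg_parts (complex.Im z).
have := normr_Re_le z; have := normr_Im_le z; lra.
Qed.

Definition atom (k : option (J * dir)) (x : X) : R[i] :=
  if k is Some p then 2%:C%C * phase p.2 * e p.1 x else 0.

Definition empirical (s : nat) (c : s.-tuple (option (J * dir))) (x : X) :=
  (s%:R^-1)%:C%C * \sum_(k <- c) atom k x.

Lemma cabs_atom k x : cabs (atom k x) <= 2.
Proof.
case: k => [[j q]|]; rewrite /atom; last by rewrite cabs0.
rewrite !cabsM cabs_real ger0_norm//.
have -> : cabs (phase q) = 1.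
  rewrite /phase; case: q.1 => /=; rewrite expr0n/= ?addr0 ?add0r sqrtr_sqr.
    by rewrite normrX normrN1 expr1n.
  by rewrite normrX normrN1 expr1n.
by rewrite mulr1 ler_piMr.
Qed.

Lemma sum_option (V : nmodType) (A : finType) (F : option A -> V) :
  \sum_k F k = F None + \sum_a F (Some a).
Proof.
rewrite (bigD1 None)//=; congr (_ + _).
rewrite (reindex_omap Some id)/=; last by case.
by apply: eq_bigl => a; rewrite eqxx.
Qed.

(** The greedy selection is run on points paired with directions, with lam = theta / 1024 and b = 2,
    followed by an exponential Markov inequality: the moment costs s theta^2 / 2^15 and each
    exceptional point gains s theta^2 / 2^14. The prefactor 4 counts the directions. *)
Lemma empirical_approx (h : J -> R[i]) (theta : R) (s : nat) (nu : X -> R) :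
  \sum_j cabs (h j) <= 1 -> 0 < theta <= 1 -> (0 < s)%N ->
  (forall x, 0 <= nu x) ->
  exists c : s.-tuple (option (J * dir)),
    \sum_(x | theta / 8 < cabs (empirical c x - synthesis h x)) nu x <=
    4 * (\sum_x nu x) * expR (- (s%:R * theta ^+ 2 / (32 * 32 * 32))).
Proof.
move=> h1 /andP[t0 t1] s0 nu0.
pose wt (k : option (J * dir)) : R :=
  if k is Some p then Num.max 0 (part p.2 (h p.1)) / 2
  else 1 - \sum_(p : J * dir) Num.max 0 (part p.2 (h p.1)) / 2.
have max0 t : 0 <= Num.max 0 t :> R by rewrite le_max lexx.
have wt0 k : 0 <= wt k.
  case: k => [p|]/=; first by rewrite divr_ge0.
  rewrite subr_ge0 (le_trans _ h1)//.
  rewrite -(pair_bigA _ (fun j q => Num.max 0 (part q (h j)) / 2))/=.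
  apply: ler_sum => j _; rewrite -mulr_suml ler_pdivrMr// mulrC.
  exact: sum_part.
have wt1 : \sum_k wt k = 1 by rewrite sum_option/= subrK.
pose K : finType := option (J * dir).
pose Y : finType := (X * dir)%type.
have [] := @greedy_exp_moment R K Y wt (fun y => nu y.1)
  (fun y => part y.2 (synthesis h y.1)) (fun k y => part y.2 (atom k y.1))
  2 (theta / (32 * 32)) s wt0 wt1.
- by move=> y; exact: nu0.
- by move=> k y; rewrite (le_trans (normr_part_le _ _))// cabs_atom.
- move=> [x q] /=; rewrite sum_option/= /part/= if_same mulr0 mulr0 add0r.
  rewrite -!/(part q _) /synthesis part_sum.
  rewrite -(pair_bigA _ (fun j r =>
    Num.max 0 (part r (h j)) / 2 * part q (2%:C%C * phase r * e j x)))/=.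
  apply: eq_bigr => j _; rewrite -{1}(sum_part_phase (h j)) mulr_suml part_sum.
  apply: eq_bigr => r _; rewrite -!mulrA !partZ.
  by field.
- by rewrite divr_ge0// ltW.
- lra.
move=> c; set S := \sum_y _ => cS; exists c.
have nuS : \sum_(y : X * dir) nu y.1 = 4 * \sum_x nu x.
  rewrite -(pair_bigA _ (fun x (q : dir) => nu x))/=.
  under eq_bigr do rewrite sumr_const card_prod card_bool -mulr_natl.
  by rewrite -mulr_sumr.
set E := \sum_(x | _) _.
have ES : E * expR (s%:R * theta ^+ 2 / (32 * 32 * 16)) <= S.
  rewrite /E mulr_suml /S.
  rewrite -(pair_bigA _ (fun x (q : dir) => nu x * expR (theta / (32 * 32) *
    (\sum_(k <- c) part q (atom k x) - s%:R * part q (synthesis h x)))))/=.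
  rewrite [leRHS](bigID (fun x => theta / 8 <
    cabs (empirical c x - synthesis h x)))/=.
  rewrite -[leLHS]addr0 lerD//; last first.
    apply: sumr_ge0 => x _; apply: sumr_ge0 => q _.
    by rewrite mulr_ge0 ?nu0 ?expR_ge0.
  apply: ler_sum => x xE.
  (* A modulus above theta / 8 forces |Re| or |Im|, hence one of the four directions, above theta /
     16. *)
  have [q qx] : exists q, theta / 16 < part q (empirical c x - synthesis h x).
    apply/not_existsP => nq.
    have {}nq q : part q (empirical c x - synthesis h x) <= theta / 16.
      by rewrite leNgt; apply/negP/nq.
    move: xE; apply/negP; rewrite -leNgt (le_trans (cabs_le_ReIm _))//.
    have := nq (false, false); have := nq (false, true).
    have := nq (true, false); have := nq (true, true).
    rewrite /part/= expr0 expr1 !mul1r !mulN1r => a1 a2 a3 a4.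
    have : `|complex.Re (empirical c x - synthesis h x)| <= theta / 16.
      by apply/ler_normlP; split; lra.
    have : `|complex.Im (empirical c x - synthesis h x)| <= theta / 16.
      by apply/ler_normlP; split; lra.
    lra.
  rewrite (bigD1 q)//= -[leLHS]addr0 lerD//; last first.
    by apply: sumr_ge0 => r _; rewrite mulr_ge0 ?nu0 ?expR_ge0.
  rewrite ler_wpM2l ?nu0// ler_expR.
  move: qx; rewrite partD partN /empirical partZ part_sum => qx.
  have s0' : 0 < s%:R :> R by rewrite ltr0n.
  have : s%:R * (theta / 16) <=
     \sum_(k <- c) part q (atom k x) - s%:R * part q (synthesis h x).
    rewrite -(ler_pM2l (x := s%:R^-1)) ?invr_gt0// mulrBr !mulKf ?lt0r_neq0//.
    exact: ltW.
  by move=> /(ler_wpM2l (ltW t0)); lra.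
rewrite -(ler_pM2r (expR_gt0 (s%:R * theta ^+ 2 / (32 * 32 * 16)))).
apply: le_trans ES _; apply: le_trans cS _; rewrite nuS -[leRHS]mulrA -expRD.
rewrite le_eqVlt; apply/orP; left; apply/eqP; congr (_ * expR _).
by field.
Qed.

End maurey.



(** * Restricted eigenvalues of sampled systems *)

Section layers.
Variable R : realType.

(** Induction by doubling: if v > 1/2 the zeroth layer alone gives 1, and otherwise v may be
    replaced by 2 v, which shifts the layers by one and scales them by 1/4. *)
Lemma sqr_layers_le (T : nat) (v : R) : 0 <= v <= 1 ->
  v ^+ 2 <= 4^-1 ^+ T + \sum_(i < T) 4^-1 ^+ i * (2^-1 ^+ i / 2 < v)%R%:R.
Proof.
elim: T v => [|T IH] v /andP[v0 v1].
  by rewrite expr0 big_ord0 addr0 expr_le1.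
rewrite big_ord_recl/= !expr0 !mul1r.
have [v2|v2] := ltP (2^-1) v.
  rewrite addrCA; apply: (@le_trans _ _ 1); first by rewrite expr_le1.
  rewrite lerDl addr_ge0 ?exprn_ge0//; apply: sumr_ge0 => i _.
  by rewrite mulr_ge0// exprn_ge0.
rewrite /= add0r.
have /IH : 0 <= 2 * v <= 1 by apply/andP; split; lra.
rewrite exprMn => h.
have -> : \sum_(i < T) 4^-1 ^+ bump 0 i * (2^-1 ^+ bump 0 i / 2 < v)%R%:R =
  4^-1 * \sum_(i < T) 4^-1 ^+ i * (2^-1 ^+ i / 2 < 2 * v)%R%:R :> R.
  rewrite mulr_sumr; apply: eq_bigr => i _; rewrite /bump/= add1n !exprS mulrA.
  by congr (_ * (_ : bool)%:R); move: (_ ^+ i) => t; apply/idP/idP => ?; lra.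
rewrite [4^-1 ^+ T.+1]exprS; move: (4^-1 ^+ T) (\sum_(i < T) _) h => t S; lra.
Qed.

Lemma sqr_layers_ge (T : nat) (v : R) : 0 <= v ->
  \sum_(i < T) 4^-1 ^+ i * (2^-1 ^+ i / 8 < v)%R%:R <= 86 * v ^+ 2.
Proof.
have geo T' (b : 'I_T' -> bool) : \sum_(i < T') 4^-1 ^+ i * (b i)%:R <= 4 / 3 :> R.
  apply: (@le_trans _ _ (4 / 3 * (1 - 4^-1 ^+ T'))); last first.
    by rewrite ler_piMr// gerBl exprn_ge0.
  elim: T' b => [|T' IH] b; first by rewrite big_ord0 expr0; lra.
  have t0 : 0 <= 4^-1 ^+ T' :> R by rewrite exprn_ge0.
  rewrite big_ord_recr/= exprS; have /= := IH (b \o widen_ord (leqnSn _)).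
  by case: (b ord_max); rewrite ?mulr1 ?mulr0; lra.
elim: T v => [|T IH] v v0.
  by rewrite big_ord0 mulr_ge0// sqr_ge0.
have [v8|v8] := ltP (8^-1) v.
  (* Here all layers together give at most 4/3, while v^2 > 1/64; 86 is the integer just above 64 *
     4/3. *)
  apply: le_trans (geo _ _) _; have : 8^-1 ^+ 2 <= v ^+ 2.
    by rewrite lerXn2r// ?nnegrE// ltW.
  by lra.
rewrite big_ord_recl/= !expr0 !mul1r ltNge v8 add0r.
have /IH : 0 <= 2 * v by lra.
rewrite exprMn => h.
have -> : \sum_(i < T) 4^-1 ^+ bump 0 i * (2^-1 ^+ bump 0 i / 8 < v)%R%:R =
  4^-1 * \sum_(i < T) 4^-1 ^+ i * (2^-1 ^+ i / 8 < 2 * v)%R%:R :> R.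
  rewrite mulr_sumr; apply: eq_bigr => i _; rewrite /bump/= add1n !exprS mulrA.
  by congr (_ * (_ : bool)%:R); move: (_ ^+ i) => t; apply/idP/idP => ?; lra.
lra.
Qed.

Variables (X : finType) (nu : X -> R).
Hypothesis nu0 : forall x, 0 <= nu x.

Definition mass (P : pred X) : R := \sum_(x | P x) nu x.

Lemma mass_cover (P Q S : pred X) : (forall x, P x -> Q x || S x) ->
  mass P <= mass Q + mass S.
Proof.
move=> PQS; rewrite /mass [leLHS]big_mkcond [X in X + _]big_mkcond [X in _ + X]big_mkcond -big_split/= ler_sum// => x _.
move: (PQS x); have := nu0 x.
by case: (P x); case: (Q x); case: (S x) => //= h; rewrite ?add0r ?addr0 ?lerDl//;
  rewrite ?addr_ge0// => /(_ isT).
Qed.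

Lemma sum_layers (T : nat) (c : R) (g : X -> R) :
  \sum_x nu x * \sum_(i < T) 4^-1 ^+ i * (2^-1 ^+ i / c < g x)%R%:R =
  \sum_(i < T) 4^-1 ^+ i * mass [pred x | 2^-1 ^+ i / c < g x].
Proof.
under eq_bigr do rewrite mulr_sumr.
rewrite exchange_big/=; apply: eq_bigr => i _.
rewrite /mass [X in _ = _ * X]big_mkcond mulr_sumr; apply: eq_bigr => x _ /=.
by case: (_ < _); rewrite ?mulr1 ?mulr0 ?mulr0// mulrC.
Qed.

End layers.

Section restricted_eigenvalue.
Variables (R : realType) (X J : finType) (e : J -> X -> R[i]).
Hypothesis e_le1 : forall j x, cabs (e j x) <= 1.
Hypothesis X_gt0 : (0 < #|X|)%N.
Hypothesis e_orthonormal : forall h : J -> R[i],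
  \sum_x #|X|%:R^-1 * cabs (synthesis e h x) ^+ 2 = \sum_j cabs (h j) ^+ 2.

Let unif (x : X) : R := #|X|%:R^-1.

(** The empirical measure as a density on [X], repeated points counted with multiplicity, so that it
    can be added to the uniform density. *)
Definition sample_weight (m : nat) (u : {ffun 'I_m -> X}) (x : X) : R :=
  \sum_(l < m) m%:R^-1 * (u l == x)%:R.

Lemma sum_sample_weight m (u : {ffun 'I_m -> X}) (g : X -> R) :
  \sum_x sample_weight u x * g x = m%:R^-1 * \sum_l g (u l).
Proof.
under eq_bigr do rewrite mulr_suml.
rewrite exchange_big/= mulr_sumr; apply: eq_bigr => l _.
rewrite (bigD1 (u l))//= eqxx mulr1 big1 ?addr0// => x /negbTE.
by rewrite eq_sym => ->; rewrite mulr0 mul0r.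
Qed.

Lemma mass_sample m (u : {ffun 'I_m -> X}) (P : pred X) :
  mass (sample_weight u) P = #|[pred l | P (u l)]|%:R / m%:R.
Proof.
rewrite /mass big_mkcond/=.
rewrite (eq_bigr (fun x => sample_weight u x * (P x)%:R)); last first.
  by move=> x _; case: (P x); rewrite ?mulr1 ?mulr0.
rewrite sum_sample_weight mulrC; congr (_ / _).
rewrite -natr_sum; congr _%:R; rewrite -sum1_card [RHS]big_mkcond.
by apply: eq_bigr => l _; rewrite inE; case: (P (u l)).
Qed.

Lemma mass_unif (P : pred X) : mass unif P = #|P|%:R / #|X|%:R.
Proof. by rewrite /mass sumr_const mulr_natl. Qed.

Lemma sample_weight_ge0 m (u : {ffun 'I_m -> X}) x : 0 <= sample_weight u x.
Proof. by apply: sumr_ge0 => l _; rewrite mulr_ge0. Qed.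

(* The set on which the approximation of level [theta] fails is small for the
   uniform and for the sampling measure simultaneously, since the approximant
   may depend on the sample; only the set [|empirical c| > theta / 4], which
   ranges over a finite family, is compared through [Huc]. *)
Lemma level_transfer m (u : {ffun 'I_m -> X}) (theta a : R) (s : nat)
    (h : J -> R[i]) :
  (0 < m)%N -> 0 < theta <= 1 -> (0 < s)%N ->
  8 * expR (- (s%:R * theta ^+ 2 / (32 * 32 * 32))) <= a / 4 ->
  (forall c : s.-tuple (option (J * (bool * bool))),
    mass unif [pred x | theta / 4 < cabs (empirical e c x)] / 2 - a / 2 <=
    mass (sample_weight u) [pred x | theta / 4 < cabs (empirical e c x)]) ->
  \sum_j cabs (h j) <= 1 ->
  mass unif [pred x | theta / 2 < cabs (synthesis e h x)] / 2 - a <=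
  mass (sample_weight u) [pred x | theta / 8 < cabs (synthesis e h x)].
Proof.
move=> m0 t01 s0 sa Huc h1.
have unif0 x : 0 <= unif x by rewrite invr_ge0.
have nu0 x : 0 <= unif x + sample_weight u x.
  by rewrite addr_ge0// sample_weight_ge0.
(* One average serves both measures because Maurey is applied to their sum, of total mass 2; this is
   the 8 = 4 * 2 of the hypothesis. *)
have [c] := empirical_approx e_le1 h1 t01 s0 nu0.
have -> : \sum_x (unif x + sample_weight u x) = 2.
  rewrite big_split/= /unif sumr_const -[X in X + _]mulr_natl divff ?pnatr_eq0 -?lt0n//.
  rewrite (eq_bigr (fun x => sample_weight u x * 1)); last by move=> ? _; rewrite mulr1.
  rewrite sum_sample_weight sumr_const card_ord mulVf// pnatr_eq0 -lt0n//.
pose exc x := theta / 8 < cabs (empirical e c x - synthesis e h x).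
rewrite big_split/= -/(mass unif exc) -/(mass (sample_weight u) exc) => Hexc.
have u1 : 0 <= mass unif exc by apply: sumr_ge0.
have u2 : 0 <= mass (sample_weight u) exc.
  by apply: sumr_ge0 => *; exact: sample_weight_ge0.
have {}Hexc : mass unif exc + mass (sample_weight u) exc <= a / 4.
  by apply: le_trans Hexc _; lra.
have := Huc c; set Z := [pred x | theta / 4 < _] => HZ.
(* The thresholds theta/2, theta/4, theta/8 leave a gap of at least theta/8 at each passage between
   the function and its average, so only exceptional points are lost. *)
have c1 : mass unif [pred x | theta / 2 < cabs (synthesis e h x)] <=
    mass unif Z + mass unif exc.
  apply: mass_cover => // x /= xF; rewrite /exc orbC; apply/orP.
  have [|xe] := ltP (theta / 8); [by left|right].
  have := cabsD (synthesis e h x - empirical e c x) (empirical e c x).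
  by rewrite subrK cabsB; lra.
have c2 : mass (sample_weight u) Z <=
    mass (sample_weight u) [pred x | theta / 8 < cabs (synthesis e h x)] +
    mass (sample_weight u) exc.
  apply: mass_cover => [x|x /= xF]; first exact: sample_weight_ge0.
  rewrite /exc orbC; apply/orP.
  have [|xe] := ltP (theta / 8); [by left|right].
  have := cabsD (empirical e c x - synthesis e h x) (synthesis e h x).
  by rewrite subrK; lra.
lra.
Qed.

(** With theta = 2^-i the exponent s theta^2 / 2^15 of [empirical_approx] becomes 4 T at every
    level. *)
Definition level_size (T : nat) (i : nat) : nat := (4 ^ i * (2 ^ 17 * T))%N.

(* The slacks are chosen so that [sum_(i < T) 4^-i * level_slack n T i] is
   [1 / (32 n)], an eighth of the smallest admissible energy [1 / (4 n)]. *)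
Definition level_slack (n T i : nat) : R := 4 ^+ i / (32 * n%:R * T%:R).

(** Finitely many conditions that do not mention h: all randomness is confined here, and the bounds
    for every h follow deterministically. *)
Definition good_sample (n T m : nat) (u : {ffun 'I_m -> X}) : Prop :=
  forall (i : 'I_T) (c : (level_size T i).-tuple (option (J * (bool * bool)))),
    mass unif [pred x | 2^-1 ^+ i / 4 < cabs (empirical e c x)] / 2 -
      level_slack n T i / 2 <=
    mass (sample_weight u) [pred x | 2^-1 ^+ i / 4 < cabs (empirical e c x)].

Lemma good_sample_unit (n T m : nat) (u : {ffun 'I_m -> X}) (h : J -> R[i]) :
  (0 < n)%N -> (3 <= T)%N -> (0 < m)%N -> (16 * n <= 2 ^ T)%N ->
  good_sample n T u -> \sum_j cabs (h j) <= 1 ->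
  (4 * n%:R)^-1 <= \sum_j cabs (h j) ^+ 2 ->
  \sum_j cabs (h j) ^+ 2 <=
    2 ^+ 9 * (m%:R^-1 * \sum_l cabs (synthesis e h (u l)) ^+ 2).
Proof.
move=> n0 T3 m0 nT good h1 hn.
have n0' : 0 < n%:R :> R by rewrite ltr0n.
have T0' : 0 < T%:R :> R by rewrite ltr0n (leq_trans _ T3).
have unif0 x : 0 <= unif x by rewrite invr_ge0.
have F1 x : 0 <= cabs (synthesis e h x) <= 1.
  rewrite cabs_ge0/= (le_trans (cabs_sum _ _ _))// (le_trans _ h1)//.
  by apply: ler_sum => j _; rewrite cabsM ler_piMr ?cabs_ge0.
set p := fun i : nat => mass unif [pred x | 2^-1 ^+ i / 2 < cabs (synthesis e h x)].
set q := fun i : nat =>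
  mass (sample_weight u) [pred x | 2^-1 ^+ i / 8 < cabs (synthesis e h x)].
have pq (i : 'I_T) : p i / 2 - level_slack n T i <= q i.
  apply: (level_transfer (s := level_size T i)) => //.
  - by rewrite exprn_gt0//= exprn_ile1//; lra.
  - by rewrite /level_size !muln_gt0 !expn_gt0/= (leq_trans _ T3).
  - have -> : (level_size T i)%:R * (2^-1 ^+ i) ^+ 2 / (32 * 32 * 32) = T%:R * 4 :> R.
      rewrite /level_size !natrM !natrX.
      have -> : (2^-1 ^+ i) ^+ 2 = (4 ^+ i)^-1 :> R.
        by rewrite exprAC -exprVn; congr (_ ^+ _); field.
      have : 4 ^+ i != 0 :> R by rewrite expf_neq0.
      by move: (4 ^+ i) => t tn0; field.
    (* Here T >= 3 enters: 1024 n T <= 64 * 2^T * 2^T <= 2^(4 T), using 16 n <= 2^T and T <= 2^T. *)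
    have e4 : 32 * 32 * n%:R * T%:R <= expR (T%:R * 4) :> R.
      apply: (@le_trans _ _ (2 ^+ (T * 4))).
        rewrite -natrX -!natrM ler_nat.
        apply: (@leq_trans ((64 * 2 ^ T) * 2 ^ T)).
          rewrite leq_mul//; last by rewrite ltnW// ltn_expl.
          by rewrite -[(32 * 32)%N]/(64 * 16)%N -mulnA leq_mul2l.
        rewrite -[64%N]/(2 ^ 6)%N -!expnD leq_exp2l//; lia.
      have -> : T%:R * 4 = (T * 4)%:R * 1 :> R by rewrite natrM mulr1.
      rewrite expRM_natl lerXn2r ?nnegrE ?expR_ge0//.
      exact: (expR_ge1Dx 1).
    apply: (@le_trans _ _ ((32 * n%:R * T%:R)^-1 / 4)).
      rewrite expRN ler_pdivrMr ?expR_gt0// mulrAC -ler_pdivrMr//.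
      by rewrite ler_pdivlMl ?mulr_gt0//; lra.
    rewrite ler_pM2r// /level_slack ler_peMl// ?invr_ge0 ?mulr_ge0//.
    by rewrite exprn_ege1//; lra.
have e0 : 0 <= \sum_j cabs (h j) ^+ 2 by apply: sumr_ge0 => j _; rewrite sqr_ge0.
have up : \sum_j cabs (h j) ^+ 2 <=
    4^-1 ^+ T + \sum_(i < T) 4^-1 ^+ i * p i.
  rewrite -e_orthonormal -/unif.
  rewrite -(sum_layers unif T 2 (fun x => cabs (synthesis e h x))).
  apply: (@le_trans _ _ (\sum_x unif x * (4^-1 ^+ T + \sum_(i < T) 4^-1 ^+ i *
      (2^-1 ^+ i / 2 < cabs (synthesis e h x))%R%:R))).
    by apply: ler_sum => x _; rewrite ler_wpM2l// sqr_layers_le.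
  under eq_bigr do rewrite mulrDr.
  rewrite big_split/= -mulr_suml /unif sumr_const -[X in X * _ + _]mulr_natl divff ?mul1r//.
  by rewrite pnatr_eq0 -lt0n.
have lo : \sum_(i < T) 4^-1 ^+ i * q i <=
    86 * (m%:R^-1 * \sum_l cabs (synthesis e h (u l)) ^+ 2).
  rewrite -(sum_layers (sample_weight u) T 8 (fun x => cabs (synthesis e h x))).
  rewrite -(sum_sample_weight u (fun x => cabs (synthesis e h x) ^+ 2)) mulr_sumr.
  apply: ler_sum => x _; rewrite mulrCA ler_wpM2l ?sample_weight_ge0//.
  by rewrite sqr_layers_ge ?cabs_ge0.
have slack : \sum_(i < T) 4^-1 ^+ i * level_slack n T i = (32 * n%:R)^-1.
  rewrite (eq_bigr (fun=> (32 * n%:R * T%:R)^-1)); last first.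
    by move=> i _; rewrite /level_slack exprVn mulKf// expf_neq0.
  rewrite sumr_const card_ord -mulr_natl; field.
  by rewrite !lt0r_neq0.
have mid : (\sum_(i < T) 4^-1 ^+ i * p i) / 2 - (32 * n%:R)^-1 <=
    \sum_(i < T) 4^-1 ^+ i * q i.
  rewrite -slack mulr_suml -sumrB; apply: ler_sum => i _.
  rewrite -mulrA -mulrBr ler_wpM2l ?exprn_ge0//.
have tail : 4^-1 ^+ T <= (16 * n%:R)^-1 :> R.
  rewrite exprVn lef_pV2 ?posrE ?mulr_gt0 ?exprn_gt0//.
  rewrite -natrX -natrM ler_nat (leq_trans nT)//.
  by rewrite leq_exp2r// (leq_trans _ T3).
(* The tail 4^-T and twice the slack are each at most a quarter of the energy, which leaves the
   constant 2 * 2 * 86 = 344 <= 2^9. *)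
move: hn tail mid; rewrite !invfM; lra.
Qed.

(** Both sides are homogeneous of degree two; after scaling to l1 norm one, the cone condition says
    that the energy is at least 1/(4 n). The zero vector is treated apart. *)
Lemma good_sample_eigenvalue (n T m : nat) (u : {ffun 'I_m -> X}) (h : J -> R[i]) :
  (0 < n)%N -> (3 <= T)%N -> (0 < m)%N -> (16 * n <= 2 ^ T)%N ->
  good_sample n T u ->
  (\sum_j cabs (h j)) ^+ 2 <= 4 * n%:R * \sum_j cabs (h j) ^+ 2 ->
  \sum_j cabs (h j) ^+ 2 <=
    2 ^+ 9 * (m%:R^-1 * \sum_l cabs (synthesis e h (u l)) ^+ 2).
Proof.
move=> n0 T3 m0 nT good hn.
have n0' : 0 < n%:R :> R by rewrite ltr0n.
set r := \sum_j cabs (h j) in hn.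
have r0 : 0 <= r by apply: sumr_ge0 => j _; rewrite cabs_ge0.
have [r_gt0|] := ltP 0 r; last first.
  move=> rle0; have {rle0} re0 : r = 0 by apply/eqP; rewrite eq_le rle0.
  rewrite big1 => [|j _].
    rewrite !mulr_ge0 ?exprn_ge0 ?invr_ge0//.
    by apply: sumr_ge0 => l _; rewrite sqr_ge0.
  have -> : cabs (h j) = 0; last by rewrite expr0n.
  exact: (psumr_eq0P (fun j _ => cabs_ge0 (h j)) re0).
have cr (c : R) (z : R[i]) : 0 <= c -> cabs (c%:C%C * z) = c * cabs z.
  by move=> c0; rewrite cabsM cabs_real ger0_norm.
have ri : 0 <= r^-1 by rewrite invr_ge0.
have := @good_sample_unit n T m u (fun j => (r^-1)%:C%C * h j) n0 T3 m0 nT good.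
have -> : \sum_j cabs ((r^-1)%:C%C * h j) = 1.
  under eq_bigr do rewrite cr//.
  by rewrite -mulr_sumr mulVf// lt0r_neq0.
have -> : \sum_j cabs ((r^-1)%:C%C * h j) ^+ 2 =
    (r^-1) ^+ 2 * \sum_j cabs (h j) ^+ 2.
  by under eq_bigr do rewrite cr// exprMn; rewrite -mulr_sumr.
have -> : \sum_l cabs (synthesis e (fun j => (r^-1)%:C%C * h j) (u l)) ^+ 2 =
    (r^-1) ^+ 2 * \sum_l cabs (synthesis e h (u l)) ^+ 2.
  rewrite mulr_sumr; apply: eq_bigr => l _; rewrite -exprMn -cr//.
  by congr (cabs _ ^+ _); rewrite /synthesis mulr_sumr; under eq_bigr do rewrite -mulrA.
have r2 : 0 < r^-1 ^+ 2 by rewrite exprn_gt0// invr_gt0.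
move=> /(_ (lexx _)) H; rewrite -(ler_pM2l r2); apply: le_trans (H _) _.
  rewrite exprVn ler_pdivlMl ?exprn_gt0// ler_pdivrMr ?mulr_gt0//.
  by rewrite mulrC.
by rewrite le_eqVlt; apply/orP; left; apply/eqP; ring.
Qed.

Lemma card_union_le (U I : finType) (A : pred U) (B : I -> pred U) :
  (forall u, A u -> exists i, B i u) -> #|A|%:R <= \sum_i #|B i|%:R :> R.
Proof.
move=> AB; rewrite -natr_sum ler_nat.
have cardE (D : pred U) : #|D| = (\sum_u D u)%N.
  by rewrite -sum1_card big_mkcond; apply: eq_bigr => u _; rewrite unfold_in; case: (D u).
rewrite cardE (eq_bigr _ (fun i _ => cardE (B i))) exchange_big/=.
apply: leq_sum => u _; have := AB u; case: (A u) => // /(_ isT)[i Bi].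
by rewrite (bigD1 i)//= Bi.
Qed.

(** At level i the union bound runs over at most exp(2^18 4^i T L) tuples, from a dictionary of four
    phases per frequency and the zero atom, whereas the Chernoff exponent is at least 2^19 4^i T
    L. *)
Lemma card_bad_sample (n T m : nat) (L : R) :
  (0 < n)%N -> (3 <= T)%N -> 1 <= L -> (4 * #|J| + 1)%:R <= expR (2 * L) ->
  2 ^+ 29 * n%:R * T%:R ^+ 2 * L <= m%:R ->
  #|[pred u : {ffun 'I_m -> X} | ~~ `[< good_sample n T u >]]|%:R <=
    expR (- (T%:R * L)) * #|X|%:R ^+ m :> R.
Proof.
move=> n0 T3 L1 JL mL.
have n0' : 0 < n%:R :> R by rewrite ltr0n.
have T0' : 0 < T%:R :> R by rewrite ltr0n (leq_trans _ T3).
pose bad (i : 'I_T) (c : (level_size T i).-tuple (option (J * (bool * bool)))) :=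
  [pred u : {ffun 'I_m -> X} |
    #|[pred l | [pred x | 2^-1 ^+ i / 4 < cabs (empirical e c x)] (u l)]|%:R / m%:R <
    #|[pred x | 2^-1 ^+ i / 4 < cabs (empirical e c x)]|%:R / #|X|%:R / 2 -
    level_slack n T i / 2 :> R].
apply: (@le_trans _ _ (\sum_(i < T) \sum_c #|bad i c|%:R)).
  apply: (@le_trans _ _ (\sum_(i < T) #|[pred u | [exists c, bad i c u]]|%:R)).
    apply: card_union_le => u /= /asboolPn nu.
    apply/not_existsP => nb; apply: nu => i c.
    rewrite leNgt; apply/negP; rewrite mass_unif mass_sample => lt; apply: (nb i).
    by apply/existsP; exists c.
  by apply: ler_sum => i _; apply: card_union_le => u /= /existsP.
apply: (@le_trans _ _ (\sum_(i < T) (expR (- (2 * (T%:R * L))) * #|X|%:R ^+ m))).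
  apply: ler_sum => i _.
  have slack0 : 0 <= level_slack n T i.
    by rewrite divr_ge0 ?exprn_ge0// !mulr_ge0.
  apply: (@le_trans _ _ (\sum_(c : (level_size T i).-tuple (option (J * (bool * bool))))
      expR (- (m%:R * level_slack n T i / 32)) * #|X|%:R ^+ m)).
    by apply: ler_sum => c _; exact: chernoff_lower.
  rewrite sumr_const -[leLHS]mulr_natl mulrA ler_wpM2r ?exprn_ge0//.
  rewrite card_tuple card_option !card_prod !card_bool natrX.
  apply: (@le_trans _ _ (expR (2 * L) ^+ level_size T i *
      expR (- (m%:R * level_slack n T i / 32)))).
    rewrite ler_wpM2r ?expR_ge0// lerXn2r ?nnegrE ?expR_ge0//.
    by rewrite (le_trans _ JL)// ler_nat; lia.
  rewrite -expRM_natl -expRD ler_expR.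
  have TL0 : 0 <= T%:R * L by rewrite mulr_ge0//; lra.
  have key : 2 ^+ 19 * 4 ^+ i * (T%:R * L) <= m%:R * level_slack n T i / 32.
    apply: le_trans (ler_wpM2r _ (ler_wpM2r slack0 mL)); last by [].
    rewrite /level_slack le_eqVlt; apply/orP; left; apply/eqP.
    by field; rewrite !lt0r_neq0.
  have i1 : 1 <= 4 ^+ i :> R by rewrite exprn_ege1//; lra.
  have -> : (level_size T i)%:R = 4 ^+ i * (2 ^+ 17 * T%:R) :> R.
    by rewrite /level_size natrM natrX natrM natrX.
  have -> : 4 ^+ i * (2 ^+ 17 * T%:R) * (2 * L) = 2 ^+ 18 * (4 ^+ i * (T%:R * L)) by ring.
  have aux (E Z W TL : R) : 2 <= E -> 2 * E * Z <= W -> 0 <= TL -> TL <= Z ->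
      E * Z - W <= - (2 * TL).
    move=> E2 EZ TL0' TLZ.
    have : 0 <= (E - 2) * Z by rewrite mulr_ge0//; lra.
    lra.
  apply: aux => //; first by rewrite -[leLHS]expr1 ler_eXn2l// ltr1n.
    rewrite -exprS mulrA. exact: key.
  by rewrite ler_peMl.
rewrite sumr_const card_ord -[leLHS]mulr_natl mulrA ler_wpM2r ?exprn_ge0//.
(* One of the two factors exp(- T L) pays for the sum over the T levels. *)
have -> : - (2 * (T%:R * L)) = - (T%:R * L) - T%:R * L by ring.
rewrite expRD mulrA mulrAC ler_piMl ?expR_ge0//.
rewrite expRN ler_pdivrMr ?expR_gt0// mul1r (le_trans _ (expR_ge1Dx _))//.
by rewrite -[leLHS]add0r lerD// ler_peMr// ltW.
Qed.

End restricted_eigenvalue.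



(** * Fourier analysis on the torus *)

Section periodicity.
Variable R : realType.

Lemma cosDint (k : int) (b : R) : cos (2 * pi * k%:~R + b) = cos b.
Proof.
have nat_case (n : nat) (c : R) : cos (2 * pi * n%:R + c) = cos c.
  rewrite addrC -(periodicn (@cosD2pi R) n c); congr (cos (_ + _)).
  by rewrite -[RHS]mulr_natr -[pi *+ 2]mulr_natl.
case: k => n; first exact: nat_case.
rewrite NegzE mulrNz mulrN -(nat_case n.+1 (_ + b)) addrA subrr add0r.
by [].
Qed.

(** Sines are reduced to cosines throughout; this is one reason why the cosine integrals below carry
    an arbitrary shift. *)
Lemma sin_cos_shift (x : R) : sin x = cos (x - pi / 2).
Proof. by rewrite cosB cos_pihalf sin_pihalf mulr0 add0r mulr1. Qed.

Lemma sinDint (k : int) (b : R) : sin (2 * pi * k%:~R + b) = sin b.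
Proof. by rewrite !sin_cos_shift -addrA cosDint. Qed.

Lemma integral_cos_period (k : int) (b : R) : k != 0 ->
  (\int[lebesgue_measure]_(x in `[0%R, 1%R[)
    (cos (2 * pi * (k%:~R * x) + b))%:E = 0)%E.
Proof.
move=> k0; set a : R := 2 * pi * k%:~R.
have a0 : a != 0 by rewrite !mulf_neq0 ?intr_eq0// gt_eqF// pi_gt0.
pose F (x : R) : R := a^-1 * sin (a * x + b).
have dF (x : R) : is_derive x 1 F (cos (a * x + b)).
  have -> : cos (a * x + b) = a^-1 *: (cos (a * x + b) * a).
    by rewrite /GRing.scale/= mulrCA mulVf// mulr1.
  apply: (@is_deriveZ R R R (fun y => sin (a * y + b)) a^-1 x 1).
  apply: (@is_derive1_comp R (@sin R) (fun y => a * y + b)).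
  have d1 : is_derive x 1 (fun y : R => a * y) a.
    have := @is_deriveZ R R R id a x 1 1 (is_derive_id x 1).
    by rewrite /GRing.scale/= mulr1.
  by have := is_deriveD d1 (is_derive_cst b x 1); rewrite addr0.
have cf : continuous (fun x : R => cos (a * x + b)).
  move=> x; apply: continuous_comp; last exact: continuous_cos.
  by apply: cvgD; [apply: cvgM; [exact: cvg_cst|exact: cvg_id]|exact: cvg_cst].
have cF : continuous F.
  move=> x; apply/differentiable_continuous/derivable1_diffP.
  exact: (@ex_derive _ _ _ _ _ _ _ (dF x)).
have eqf : (fun x : R => (cos (2 * pi * (k%:~R * x) + b))%:E) =
    (fun x => (cos (a * x + b))%:E) by apply/funext => x; rewrite /a !mulrA.
rewrite eqf integral_itv_bndo_bndc; last first.
  by apply/measurable_EFinP/measurable_funTS; exact: continuous_measurable_fun.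
rewrite (@continuous_FTC2 _ _ F)//.
- rewrite /F mulr1 mulr0 add0r -EFinB -mulrBr.
  by rewrite /a sinDint subrr mulr0.
- exact/continuous_subspaceT.
- split.
  + by move=> x _; exact: (@ex_derive _ _ _ _ _ _ _ (dF x)).
  + by apply: cvg_at_right_filter; exact: cF.
  + by apply: cvg_at_left_filter; exact: cF.
- by move=> x _; rewrite derive1E; exact: (@derive_val _ _ _ _ _ _ _ (dF x)).
Qed.

End periodicity.

Section bounded_measurable.
Context d (T : measurableType d) (R : realType).

(** An algebra of functions integrable against every probability measure, which settles all
    integrability conditions at once. *)
Definition bounded_measurable (f : T -> R) : Prop :=
  measurable_fun setT f /\ exists B : R, forall x, `|f x| <= B.

Lemma bounded_measurable_integrable (P : probability T R) f :
  bounded_measurable f -> P.-integrable setT (EFin \o f).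
Proof.
move=> [mf [B fB]]; apply: measurable_bounded_integrable => //.
  by rewrite -ge0_fin_numE// fin_num_measure.
exists B; split; first exact: num_real.
by move=> y By x _ /=; exact: le_trans (fB x) (ltW By).
Qed.

Lemma bounded_measurable_cst (c : R) : bounded_measurable (cst c).
Proof. by split; [exact: measurable_cst|exists `|c| => x]. Qed.

Lemma bounded_measurableD f g : bounded_measurable f -> bounded_measurable g ->
  bounded_measurable (fun x => f x + g x).
Proof.
move=> [mf [A fA]] [mg [B gB]]; split; first exact: measurable_funD.
by exists (A + B) => x; rewrite (le_trans (ler_normD _ _))// lerD.
Qed.

Lemma bounded_measurableM f g : bounded_measurable f -> bounded_measurable g ->
  bounded_measurable (fun x => f x * g x).
Proof.
move=> [mf [A fA]] [mg [B gB]]; split; first exact: measurable_funM.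
by exists (A * B) => x; rewrite normrM ler_pM.
Qed.

Lemma bounded_measurableN f : bounded_measurable f ->
  bounded_measurable (fun x => - f x).
Proof.
move=> [mf [A fA]]; split; first exact: measurableT_comp.
by exists A => x; rewrite normrN.
Qed.

Lemma bounded_measurable_cos f : measurable_fun setT f ->
  bounded_measurable (fun x => cos (f x)).
Proof.
move=> mf; split.
  apply: measurableT_comp => //; apply: continuous_measurable_fun.
  exact: continuous_cos.
by exists 1 => x; rewrite ler_norml cos_geN1 cos_le1.
Qed.

End bounded_measurable.

Lemma Rintegral_probability_cst d (T : measurableType d) (R : realType)
  (P : probability T R) (c : R) : \int[P]_x c = c.
Proof.
transitivity (c * fine (P setT)); first exact: Rintegral_cst.
by rewrite probability_setT mulr1.
Qed.

Section haar_integral.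
Variable R : realType.

Lemma integral_circle (g : R -> R) : bounded_measurable g ->
  (\int[@circle_haar R]_x (g (cval x))%:E =
   \int[lebesgue_measure]_(x in `[0%R, 1%R[) (g x)%:E)%E.
Proof.
move=> [mg [B gB]].
pose M : measurableType _ := measurableTypeR R.
pose v : circle R -> M := @cval R.
have mv : measurable_fun setT v by move=> _ A mA; exists A.
have vT : v @^-1` `[0%R, 1%R[%classic = setT.
  by apply/seteqP; split => // x _ /=; rewrite in_itv/=; exact: cvalP.
have bg : bounded_measurable (fun x : circle R => g (cval x)).
  by split; [exact: (measurableT_comp mg mv)|exists B => x; exact: gB].
rewrite -[in LHS]vT.
have -> : (\int[@circle_haar R]_(x in v @^-1` `[0%R, 1%R[%classic) (g (cval x))%:E =
    \int[pushforward (@circle_haar R) v]_(x in `[0%R, 1%R[%classic) (g x)%:E)%E.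
  rewrite (integral_pushforward mv)//.
  - exact/measurable_EFinP.
  - by rewrite vT; exact: bounded_measurable_integrable.
apply: eq_measure_integral => A mA A01.
transitivity (lebesgue_measure (`[0%R, 1%R[%classic `&` A)).
  by rewrite -image_cval_preimage.
by congr lebesgue_measure; rewrite setIC; exact/setIidPl.
Qed.

Lemma integral_haarS d (f : torus R d.+1 -> R) : bounded_measurable f ->
  \int[haar R d.+1]_x f x =
  \int[@circle_haar R]_a \int[haar R d]_x f (torus_cons (a, x)).
Proof.
move=> bf; have [mf [B fB]] := bf.
have mfc : measurable_fun setT (f \o @torus_cons R d).
  by apply: measurableT_comp => //; exact: measurable_torus_cons.
have bfc : bounded_measurable (f \o @torus_cons R d).
  by split => //; exists B => x; exact: fB.
rewrite /Rintegral /=; congr fine.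
rewrite integral_distribution//=; last 2 first.
- exact/measurable_EFinP.
- exact: (@bounded_measurable_integrable _ _ _ (@circle_haar R \x haar R d)%E).
rewrite -integral12_prod_meas1; last first.
  exact: (@bounded_measurable_integrable _ _ _ (@circle_haar R \x haar R d)%E).
apply: eq_integral => a _; rewrite /fubini_F fineK//.
apply: integrable_fin_num => //.
apply: (@bounded_measurable_integrable _ _ _ (haar R d)).
split; last by exists B => x; exact: fB.
exact: (measurableT_comp mfc (pair1_measurable a)).
Qed.

Lemma measurable_phase d (k : freq d) :
  measurable_fun setT
    (fun x : torus R d => \sum_(i < d) (k i)%:~R * cval (tnth x i)).
Proof.
apply: measurable_sum => i; apply: measurable_funM => //.
apply: (measurableT_comp (f := @cval R)); last exact: measurable_tnth.
by move=> _ A mA; exists A.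
Qed.

(** Induction on the dimension, the phase of the first coordinate being absorbed into the shift b.
    Either the remaining frequency is nonzero and the inner integral vanishes, or the integrand
    depends on the first coordinate only and is integrated over whole periods. *)
Lemma integral_cos_phase d (k : freq d) (b : R) : k != [ffun=> 0] ->
  \int[haar R d]_x cos (2 * pi * (\sum_(i < d) (k i)%:~R * cval (tnth x i)) + b)
  = 0.
Proof.
elim: d k b => [|d IH] k b k0.
  by case/eqP: k0; apply/ffunP => -[].
rewrite integral_haarS; last first.
  apply: bounded_measurable_cos; apply: measurable_funD => //.
  by apply: measurable_funM => //; exact: measurable_phase.
pose k' : freq d := [ffun i => k (lift ord0 i)].
have split_phase a (x : torus R d) :
    2 * pi * (\sum_(i < d.+1) (k i)%:~R * cval (tnth (torus_cons (a, x)) i)) + b =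
    2 * pi * (\sum_(i < d) (k' i)%:~R * cval (tnth x i)) +
    (2 * pi * ((k ord0)%:~R * cval a) + b).
  rewrite big_ord_recl tnth0 mulrDr [_ + 2 * pi * _]addrC addrA; congr (_ * _ + _ + _).
  by apply: eq_bigr => i _; rewrite ffunE tnthS.
under eq_Rintegral do under eq_Rintegral do rewrite split_phase.
have [k'0|k'0] := eqVneq k' [ffun=> 0]; last first.
  by under eq_Rintegral do rewrite IH//; exact: Rintegral_probability_cst.
have k00 : k ord0 != 0.
  apply: contra k0 => /eqP k00; apply/eqP/ffunP => i; rewrite ffunE.
  have [j|] := unliftP ord0 i; last by move=> ->.
  by move=> ->; have := congr1 (fun g : freq d => g j) k'0; rewrite !ffunE.
transitivity (\int[@circle_haar R]_a cos (2 * pi * ((k ord0)%:~R * cval a) + b)).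
  apply: eq_Rintegral => a _.
  under eq_Rintegral => x _.
    rewrite big1 ?mulr0 ?add0r; last first.
      by move=> i _; rewrite k'0 ffunE mul0r.
    over.
  exact: Rintegral_probability_cst.
rewrite /Rintegral (@integral_circle (fun y => cos (2 * pi * ((k ord0)%:~R * y) + b))).
  by rewrite integral_cos_period.
apply: bounded_measurable_cos; apply: measurable_funD => //.
by apply: measurable_funM => //; exact: measurable_funM.
Qed.

End haar_integral.



Section complex_integral.
Context d (T : measurableType d) (R : realType).
Implicit Types f g : T -> R[i].

Lemma Linfty_Re f : Linfty T f -> bounded_measurable (fun x => complex.Re (f x)).
Proof.
move=> [[mR _] [B fB]]; split => //; exists B => x.
exact: le_trans (normr_Re_le _) (fB x).
Qed.

Lemma Linfty_Im f : Linfty T f -> bounded_measurable (fun x => complex.Im (f x)).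
Proof.
move=> [[_ mI] [B fB]]; split => //; exists B => x.
exact: le_trans (normr_Im_le _) (fB x).
Qed.

Lemma Linfty_ReIm f : bounded_measurable (fun x => complex.Re (f x)) ->
  bounded_measurable (fun x => complex.Im (f x)) -> Linfty T f.
Proof.
move=> [mR [A fA]] [mI [B fB]]; split => //; exists (A + B) => x.
by rewrite (le_trans (cabs_le_ReIm _))// lerD.
Qed.

Lemma Linfty_cst (c : R[i]) : Linfty T (fun=> c).
Proof. by apply: Linfty_ReIm; exact: bounded_measurable_cst. Qed.

Lemma LinftyD f g : Linfty T f -> Linfty T g -> Linfty T (fun x => f x + g x).
Proof.
move=> Lf Lg; apply: Linfty_ReIm.
  under eq_fun do rewrite cReD.
  by apply: bounded_measurableD; exact: Linfty_Re.
under eq_fun do rewrite cImD.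
by apply: bounded_measurableD; exact: Linfty_Im.
Qed.

Lemma LinftyM f g : Linfty T f -> Linfty T g -> Linfty T (fun x => f x * g x).
Proof.
move=> Lf Lg; apply: Linfty_ReIm.
  under eq_fun do rewrite cReM.
  apply: bounded_measurableD; [|apply: bounded_measurableN];
    apply: bounded_measurableM; (exact: Linfty_Re) || (exact: Linfty_Im).
under eq_fun do rewrite cImM.
by apply: bounded_measurableD; apply: bounded_measurableM;
  (exact: Linfty_Re) || (exact: Linfty_Im).
Qed.

Lemma LinftyZ (c : R[i]) f : Linfty T f -> Linfty T (fun x => c * f x).
Proof. exact: (LinftyM (Linfty_cst c)). Qed.

Lemma LinftyB f g : Linfty T f -> Linfty T g -> Linfty T (fun x => f x - g x).
Proof.
move=> Lf Lg; under eq_fun do rewrite -mulN1r.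
exact: (LinftyD Lf (LinftyZ _ Lg)).
Qed.

Lemma Linfty_conj f : Linfty T f -> Linfty T (fun x => conjc (f x)).
Proof.
move=> Lf; apply: Linfty_ReIm.
  have -> : (fun x => complex.Re (conjc (f x))) = (fun x => complex.Re (f x)).
    by apply/funext => x; case: (f x).
  exact: Linfty_Re.
have -> : (fun x => complex.Im (conjc (f x))) = (fun x => - complex.Im (f x)).
  by apply/funext => x; case: (f x).
by apply: bounded_measurableN; exact: Linfty_Im.
Qed.

Lemma Linfty_sum (I : Type) (r : seq I) (F : I -> T -> R[i]) :
  (forall i, Linfty T (F i)) -> Linfty T (fun x => \sum_(i <- r) F i x).
Proof.
move=> LF; elim: r => [|i r IH].
  by under eq_fun do rewrite big_nil; exact: Linfty_cst.
by under eq_fun do rewrite big_cons; exact: LinftyD.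
Qed.

Variable P : probability T R.

Lemma cintegralD f g : Linfty T f -> Linfty T g ->
  cintegral P (fun x => f x + g x) = cintegral P f + cintegral P g.
Proof.
move=> Lf Lg; rewrite /cintegral.
under eq_Rintegral do rewrite cReD.
under [X in Complex _ X]eq_Rintegral do rewrite cImD.
by rewrite !RintegralD//; apply: bounded_measurable_integrable;
  (exact: Linfty_Re) || (exact: Linfty_Im).
Qed.

Lemma cintegralZ (c : R[i]) f : Linfty T f ->
  cintegral P (fun x => c * f x) = c * cintegral P f.
Proof.
move=> Lf; rewrite /cintegral.
under eq_Rintegral do rewrite cReM.
under [X in Complex _ X]eq_Rintegral do rewrite cImM.
have iR : P.-integrable setT (EFin \o (fun x => complex.Re (f x))).
  by apply: bounded_measurable_integrable; exact: Linfty_Re.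
have iI : P.-integrable setT (EFin \o (fun x => complex.Im (f x))).
  by apply: bounded_measurable_integrable; exact: Linfty_Im.
have iZ (a : R) (h : T -> R) : bounded_measurable h ->
    P.-integrable setT (EFin \o (fun x => a * h x)).
  move=> bh; apply: bounded_measurable_integrable.
  exact: (bounded_measurableM (bounded_measurable_cst T a) bh).
have bR := Linfty_Re Lf; have bI := Linfty_Im Lf.
rewrite RintegralB ?RintegralD//; try exact: iZ.
rewrite !RintegralZl//.
by case: c.
Qed.

Lemma cintegral_sum (I : Type) (r : seq I) (F : I -> T -> R[i]) :
  (forall i, Linfty T (F i)) ->
  cintegral P (fun x => \sum_(i <- r) F i x) = \sum_(i <- r) cintegral P (F i).
Proof.
move=> LF; elim: r => [|i r IH].
  under eq_fun do rewrite big_nil.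
  rewrite big_nil /cintegral/= !Rintegral_probability_cst.
  by [].
under eq_fun do rewrite big_cons.
by rewrite cintegralD ?IH ?big_cons//; exact: Linfty_sum.
Qed.

(** Rotation: for z the integral of f, |z|^2 is the integral of Re(conj z * f), to which real
    monotonicity applies. *)
Lemma cabs_cintegral_le f (psi : T -> R) : Linfty T f ->
  bounded_measurable psi -> (forall x, cabs (f x) <= psi x) ->
  cabs (cintegral P f) <= \int[P]_x psi x.
Proof.
move=> Lf bpsi fpsi; set z := cintegral P f.
have psi0 : 0 <= \int[P]_x psi x.
  by apply: Rintegral_ge0 => x _; rewrite (le_trans _ (fpsi x))// cabs_ge0.
have [z0|z0] := leP (cabs z) 0; first exact: le_trans psi0.
rewrite -(ler_pM2l z0) -expr2.
have Lzf := LinftyZ (conjc z) Lf.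
have -> : cabs z ^+ 2 = complex.Re (cintegral P (fun x => conjc z * f x)).
  rewrite cintegralZ// -/z; case: z {z0 Lzf} => a b /=.
  by rewrite sqr_sqrtr ?addr_ge0 ?sqr_ge0// mulNr opprK -!expr2.
rewrite -RintegralZl//; last exact: bounded_measurable_integrable.
apply: le_Rintegral => //.
- by apply: bounded_measurable_integrable; exact: Linfty_Re.
- apply: bounded_measurable_integrable.
  exact: (bounded_measurableM (bounded_measurable_cst T (cabs z)) bpsi).
move=> x _; apply: le_trans (ler_norm _) _; apply: le_trans (normr_Re_le _) _.
rewrite cabsM ler_pM ?cabs_ge0//.
by case: z {z0 Lzf} => a b /=; rewrite sqrrN.
Qed.

End complex_integral.

Section exponentials.
Variables (R : realType) (d : nat).
Implicit Types (k l : freq d) (x : torus R d).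

Definition freqD k l : freq d := [ffun i => k i + l i].
Definition freqB k l : freq d := [ffun i => k i - l i].

Lemma phaseD k l x : \sum_(i < d) (freqD k l i)%:~R * cval (tnth x i) =
  \sum_(i < d) (k i)%:~R * cval (tnth x i) +
  \sum_(i < d) (l i)%:~R * cval (tnth x i) :> R.
Proof. by rewrite -big_split; apply: eq_bigr => i _; rewrite ffunE intrD mulrDl. Qed.

Lemma expkD k l x : expk (freqD k l) x = expk k x * expk l x :> R[i].
Proof.
rewrite /expk phaseD mulrDr cosD sinD.
by apply/eqP; rewrite eq_complex cReM cImM /= eqxx addrC eqxx.
Qed.

Lemma expk_subK k l x : expk k x * conjc (expk l x) = expk (freqB k l) x :> R[i].
Proof.
have -> : expk k x = expk (freqB k l) x * expk l x :> R[i].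
  by rewrite -expkD; congr expk; apply/ffunP => i; rewrite !ffunE subrK.
rewrite -mulrA; have -> : expk l x * conjc (expk l x) = 1 :> R[i].
  apply/eqP; rewrite eq_complex cReM cImM /= mulrN opprK -!expr2 cos2Dsin2 eqxx/=.
  by rewrite mulrN mulrC addNr.
by rewrite mulr1.
Qed.

Lemma cabs_expk k x : cabs (expk k x : R[i]) = 1.
Proof. by rewrite /expk/= cos2Dsin2 sqrtr1. Qed.

Lemma Linfty_expk k : Linfty (torus R d) (@expk R d k).
Proof.
have mp : measurable_fun setT
    (fun x : torus R d => 2 * pi * \sum_(i < d) (k i)%:~R * cval (tnth x i)).
  by apply: measurable_funM => //; exact: measurable_phase.
apply: Linfty_ReIm; first exact: bounded_measurable_cos.
under eq_fun do rewrite /expk/= sin_cos_shift.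
by apply: bounded_measurable_cos; exact: measurable_funB.
Qed.

Lemma cintegral_expk k :
  cintegral (haar R d) (@expk R d k) = (k == [ffun=> 0])%:R.
Proof.
have [->|k0] := eqVneq k [ffun=> 0].
  have e1 : @expk R d [ffun=> 0] = fun=> 1.
    apply/funext => x; rewrite /expk big1 ?mulr0 ?cos0 ?sin0// => i _.
    by rewrite ffunE mul0r.
  by rewrite e1 /cintegral/= !Rintegral_probability_cst.
rewrite /cintegral /expk/=.
under eq_Rintegral do rewrite -[X in cos X]addr0.
rewrite integral_cos_phase//.
under eq_Rintegral do rewrite sin_cos_shift.
by rewrite integral_cos_phase.
Qed.

Variables (G : finType) (fq : G -> freq d).
Hypothesis fq_inj : injective fq.

Definition tpoly (c : G -> R[i]) (x : torus R d) : R[i] :=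
  \sum_g c g * expk (fq g) x.

Lemma Linfty_tpoly c : Linfty (torus R d) (tpoly c).
Proof. by apply: Linfty_sum => g; apply: LinftyZ; exact: Linfty_expk. Qed.

Lemma fourier_expk k l : fourier (@expk R d k) l = (k == l)%:R.
Proof.
rewrite /fourier; under eq_fun do rewrite expk_subK.
rewrite cintegral_expk; congr (nat_of_bool _)%:R.
apply/eqP/eqP => [/ffunP kl|->]; apply/ffunP => i; last by rewrite !ffunE subrr.
by apply/eqP; rewrite -subr_eq0; have := kl i; rewrite !ffunE => ->.
Qed.

Lemma fourierD f g k : Linfty (torus R d) f -> Linfty (torus R d) g ->
  fourier (fun x => f x + g x) k = fourier f k + fourier g k.
Proof.
move=> Lf Lg; rewrite /fourier; under eq_fun do rewrite mulrDl.
by rewrite cintegralD//; apply: LinftyM => //; apply: Linfty_conj;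
  exact: Linfty_expk.
Qed.

Lemma fourierZ (c : R[i]) f k : Linfty (torus R d) f ->
  fourier (fun x => c * f x) k = c * fourier f k.
Proof.
move=> Lf; rewrite /fourier; under eq_fun do rewrite -mulrA.
by rewrite cintegralZ//; apply: LinftyM => //; apply: Linfty_conj;
  exact: Linfty_expk.
Qed.

Lemma cabs_fourier_le f k (B : R) : Linfty (torus R d) f ->
  (forall x, cabs (f x) <= B) -> cabs (fourier f k) <= B.
Proof.
move=> Lf fB; rewrite -[leRHS](Rintegral_probability_cst (haar R d)).
apply: cabs_cintegral_le; last by move=> x; rewrite cabsM cabs_conj cabs_expk mulr1.
  by apply: LinftyM => //; apply: Linfty_conj; exact: Linfty_expk.
exact: bounded_measurable_cst.
Qed.

Lemma bounded_measurable_cabs2 (f : torus R d -> R[i]) : Linfty (torus R d) f ->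
  bounded_measurable (fun x => cabs (f x) ^+ 2).
Proof.
move=> Lf; under eq_fun do rewrite cabs_sqr !expr2.
by apply: bounded_measurableD; apply: bounded_measurableM;
  (exact: Linfty_Re) || (exact: Linfty_Im).
Qed.

Lemma fourier_tpoly c g : fourier (tpoly c) (fq g) = c g.
Proof.
have Le h := Linfty_conj (Linfty_expk (fq h)).
rewrite /fourier /tpoly; under eq_fun do rewrite mulr_suml.
rewrite (@cintegral_sum _ _ _ (haar R d)); last first.
  by move=> h; apply: LinftyM => //; apply: LinftyZ; exact: Linfty_expk.
rewrite (bigD1 g)//= -/(fourier _ _) fourierZ; last exact: Linfty_expk.
rewrite fourier_expk eqxx mulr1 big1 ?addr0// => h hg.
rewrite -/(fourier _ _) fourierZ; last exact: Linfty_expk.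
by rewrite fourier_expk (inj_eq fq_inj) (negbTE hg) mulr0.
Qed.

Lemma parseval c :
  \int[haar R d]_x cabs (tpoly c x) ^+ 2 = \sum_g cabs (c g) ^+ 2.
Proof.
have Lt := Linfty_tpoly c.
have Le g := Linfty_conj (Linfty_expk (fq g)).
transitivity (complex.Re (cintegral (haar R d) (fun x => tpoly c x * conjc (tpoly c x)))).
  by rewrite /cintegral/=; apply: eq_Rintegral => x _; rewrite mulc_conjE.
have conj_sum x : conjc (tpoly c x) = \sum_g conjc (c g) * conjc (expk (fq g) x).
  by rewrite /tpoly rmorph_sum/=; apply: eq_bigr => g _; rewrite rmorphM.
under eq_fun do rewrite conj_sum mulr_sumr.
rewrite (@cintegral_sum _ _ _ (haar R d)); last first.
  by move=> g; apply: LinftyM => //; apply: LinftyZ.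
rewrite cRe_sum; apply: eq_bigr => g _.
under eq_fun do rewrite mulrCA.
rewrite cintegralZ; last exact: LinftyM.
by rewrite -/(fourier _ _) fourier_tpoly mulrC mulc_conjE.
Qed.

End exponentials.



(** * The de la Vallee Poussin operator *)

Section boxes.
Variable d : nat.

(** The cube of frequencies is enumerated by the same finite type as the grid points, so the
    dictionary and the sample space have equal cardinality. *)
Definition box (D : nat) (g : {ffun 'I_d -> 'I_(2 * D + 1)}) : freq d :=
  [ffun i => (g i : nat)%:Z - D%:Z].

Lemma box_inj D : injective (@box D).
Proof.
move=> g h /ffunP gh; apply/ffunP => i; apply/val_inj => /=.
by have := gh i; rewrite !ffunE /=; lia.
Qed.

Lemma box_cube D g : cube d D (@box D g).
Proof. by move=> i; rewrite ffunE; have := ltn_ord (g i); lia. Qed.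

Lemma cube_box D (k : freq d) : cube d D k -> exists g, @box D g = k.
Proof.
move=> kD; have lt i : (absz (k i + D%:Z)%R < 2 * D + 1)%N by have := kD i; lia.
by exists [ffun i => Ordinal (lt i)]; apply/ffunP => i; rewrite !ffunE/=;
  have := kD i; lia.
Qed.

(** Serves both for sums over the cube and for the sum over all frequencies in [vp_operator], whose
    terms vanish off the cube. *)
Lemma sum_box (V : nmodType) (D : nat) (A : set (freq d)) (F : freq d -> V) :
  cube d D `<=` A -> (forall k, A k -> ~ cube d D k -> F k = 0) ->
  \sum_(k \in A) F k = \sum_g F (@box D g).
Proof.
move=> DA F0; rewrite (@fsbigE _ _ _ _ _ (map (@box D) (index_enum {ffun 'I_d -> 'I_(2 * D + 1)}))).
- by rewrite big_map; apply: eq_bigl => g; apply/mem_set/DA/box_cube.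
- by rewrite map_inj_uniq ?index_enum_uniq//; exact: box_inj.
- by move=> k /= /mapP[g _ ->]; apply/DA/box_cube.
move=> k Ak kE; apply: F0 => // /cube_box[g gk].
by move/negP: kE; apply; apply/mapP; exists g; rewrite ?mem_index_enum.
Qed.

Lemma sum_cube (V : nmodType) (D : nat) (F : freq d -> V) :
  \sum_(k \in cube d D) F k = \sum_g F (@box D g).
Proof. exact: sum_box. Qed.

End boxes.

Section vp_counting.
Variable R : realType.

Lemma card_interval (n lo hi : nat) :
  (\sum_(q < n) ((lo <= q) && (q <= hi)) = minn n hi.+1 - lo)%N.
Proof. by elim: n => [|n IH]; rewrite ?big_ord0 ?big_ord_recr/= ?IH; lia. Qed.

(** The trapezoid is a normalised convolution of the indicators of [-a, a] and [-b, b], so its value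
    at k counts the representations k = p + q. For given q at most one p fits, and the admissible q
    form an interval. *)
Lemma vp_coef_count (a b : nat) (k : int) : (b <= a)%N ->
  (2 * b + 1)%:R * vp_coef R a b k =
  (\sum_(p < 2 * a + 1) \sum_(q < 2 * b + 1)
    (p%:Z - a%:Z + (q%:Z - b%:Z) == k)%R)%N%:R.
Proof.
move=> ba.
have -> : (\sum_(p < 2 * a + 1) \sum_(q < 2 * b + 1)
    (p%:Z - a%:Z + (q%:Z - b%:Z) == k)%R =
    if `|k| <= a - b then 2 * b + 1 else if `|k| <= a + b then a + b + 1 - `|k|
    else 0)%N.
  rewrite exchange_big/=.
  have inner (q : 'I_(2 * b + 1)) : (\sum_(p < 2 * a + 1)
      (p%:Z - a%:Z + (q%:Z - b%:Z) == k)%R =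
      ((0 <= k + a%:Z + b%:Z - q%:Z)%R && (k + a%:Z + b%:Z - q%:Z <= (2 * a)%N%:Z)%R))%N.
    set t := k + a%:Z + b%:Z - q%:Z.
    have [t0|t0] := leP 0 t; last first.
      by rewrite big1 => [|p _]; move: t0; rewrite /t; lia.
    rewrite (eq_bigr (fun p : 'I_(2 * a + 1) => ((`|t| <= p) && (p <= `|t|))%N : nat)).
      by rewrite card_interval; lia.
    by move=> p _; congr nat_of_bool; move: t0; rewrite /t; lia.
  rewrite (eq_bigr _ (fun q _ => inner q)).
  have [neg|pos] := ltP (k + a%:Z + b%:Z) 0.
    by rewrite big1 => [|q _]; [case: ifP => ?; [|case: ifP => ?]; lia|lia].
  rewrite (eq_bigr (fun q : 'I_(2 * b + 1) => ((absz (Num.max 0 (k + b%:Z - a%:Z))%R <= q) &&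
    (q <= absz (k + a%:Z + b%:Z)%R))%N : nat)); last by move=> q _; lia.
  by rewrite card_interval; case: ifP => ?; [|case: ifP => ?]; lia.
have b0 : (2 * b + 1)%:R != 0 :> R by rewrite pnatr_eq0; lia.
rewrite /vp_coef; case: ifP => _; first by rewrite mulr1.
case: ifP => kab; last by rewrite mulr0.
by rewrite mulrC divfK// natrB//; lia.
Qed.

Lemma prod_bool (I : finType) (P : pred I) :
  \prod_i (P i)%:R = [forall i, P i]%:R :> R.
Proof.
have [/forallP PI|/forallPn[i Pi]] := boolP [forall i, P i].
  by rewrite big1// => i _; rewrite PI.
by rewrite (bigD1 i)//= (negbTE Pi) mul0r.
Qed.

Lemma vp_weight_count (d a b : nat) (k : freq d) : (b <= a)%N ->
  (2 * b + 1)%:R ^+ d * \prod_(i < d) vp_coef R a b (k i) =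
  \sum_P \sum_Q (freqD (@box d a P) (@box d b Q) == k)%:R.
Proof.
move=> ba; rewrite -[d in _ ^+ d]card_ord -prodr_const -big_split/=.
under eq_bigr do rewrite vp_coef_count// natr_sum.
rewrite bigA_distr_bigA/=; apply: eq_bigr => P _.
under eq_bigr do rewrite natr_sum.
rewrite bigA_distr_bigA/=; apply: eq_bigr => Q _.
rewrite prod_bool; congr (nat_of_bool _)%:R.
apply/forallP/eqP => [PQ|<- i]; last by rewrite !ffunE.
by apply/ffunP => i; have /eqP := PQ i; rewrite !ffunE.
Qed.

(** The ratio of the bases is at most 1 + 1/d, so its d-th power is at most e. This is why the
    orders (d+1) M and d M give a norm bound independent of the dimension. *)
Lemma vp_ratio (d M : nat) : (0 < d)%N ->
  (2 * (d.+1 * M) + 1)%:R ^+ d <= 4 * (2 * (d * M) + 1)%:R ^+ d :> R.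
Proof.
move=> d0; have d0' : 0 < d%:R :> R by rewrite ltr0n.
have le1 : (2 * (d.+1 * M) + 1)%:R <= expR (d%:R^-1) * (2 * (d * M) + 1)%:R :> R.
  apply: (@le_trans _ _ ((1 + d%:R^-1) * (2 * (d * M) + 1)%:R)); last first.
    by rewrite ler_wpM2r// expR_ge1Dx.
  rewrite -(ler_pM2l d0') mulrA mulrDr mulr1 divff ?lt0r_neq0//.
  by rewrite natr1 -!natrM ler_nat; lia.
apply: le_trans (_ : _ <= (expR (d%:R^-1) * (2 * (d * M) + 1)%:R) ^+ d) _.
  by rewrite lerXn2r// ?nnegrE// mulr_ge0// expR_ge0.
rewrite exprMn ler_wpM2r ?exprn_ge0//.
rewrite -expRM_natl divff ?lt0r_neq0//.
exact: expR1_le4.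
Qed.

End vp_counting.

Section vallee_poussin.
Variables (R : realType) (d M : nat).
Hypothesis d_gt0 : (0 < d)%N.

(** Here a - b = M, up to which the weights are 1, and a + b = D, beyond which they vanish. *)
Let a := (d.+1 * M)%N.
Let b := (d * M)%N.
Let D := ((2 * d + 1) * M)%N.

Definition vp_weight (k : freq d) : R := \prod_(i < d) vp_coef R a b (k i).

Lemma vp_weight_out k : ~ cube d D k -> vp_weight k = 0.
Proof.
move=> kD; have [i ki] : exists i, ~~ (`|k i| <= D)%N.
  by apply/not_existsP => nk; apply: kD => i; have /negP := nk i; rewrite negbK.
rewrite /vp_weight (bigD1 i)//= /vp_coef !ifN ?mul0r//; move: ki; rewrite /D /a /b; nia.
Qed.

Lemma vp_weight_in k : cube d M k -> vp_weight k = 1.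
Proof.
move=> kM; rewrite /vp_weight big1// => i _; rewrite /vp_coef ifT//.
by have := kM i; rewrite /a /b; nia.
Qed.

Lemma vp_operatorE (f : torus R d -> R[i]) x :
  vp_operator M f x = \sum_g (vp_weight (@box d D g))%:C%C *
    fourier f (@box d D g) * expk (@box d D g) x.
Proof.
rewrite /vp_operator (@sum_box d _ D)// => k _ kD.
by rewrite -/a -/b -/(vp_weight k) vp_weight_out// !mul0r.
Qed.

Lemma vp_operatorB (f g : torus R d -> R[i]) x :
  Linfty (torus R d) f -> Linfty (torus R d) g ->
  vp_operator M (fun y => f y - g y) x = vp_operator M f x - vp_operator M g x.
Proof.
move=> Lf Lg; rewrite !vp_operatorE -sumrB; apply: eq_bigr => k _.
rewrite -mulrBl -mulrBr; congr (_ * _ * _).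
have -> : (fun y => f y - g y) = (fun y => f y + (-1) * g y).
  by apply/funext => y; rewrite mulN1r.
by rewrite fourierD// ?fourierZ ?mulN1r//; exact: LinftyZ.
Qed.

Lemma vp_operatorZ (c : R[i]) (f : torus R d -> R[i]) x :
  Linfty (torus R d) f ->
  vp_operator M (fun y => c * f y) x = c * vp_operator M f x.
Proof.
move=> Lf; rewrite !vp_operatorE mulr_sumr; apply: eq_bigr => k _.
by rewrite fourierZ// mulrCA !mulrA.
Qed.

Lemma Linfty_trigo_poly A (c : freq d -> R[i]) :
  Linfty (torus R d) (trigo_poly A c).
Proof. by apply: Linfty_sum => k; apply: LinftyZ; exact: Linfty_expk. Qed.

Lemma vp_operator_trigo_poly A (c : freq d -> R[i]) x :
  vp_operator M (trigo_poly A c) x =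
  trigo_poly A (fun k => (vp_weight k)%:C%C * c k) x.
Proof.
have Lk (k : freq d) : Linfty (torus R d) (fun x => c k * expk k x).
  by apply: LinftyZ; exact: Linfty_expk.
have fT k : fourier (trigo_poly A c) k = \sum_(l <- A) c l * (l == k)%:R.
  rewrite /fourier /trigo_poly; under eq_fun do rewrite mulr_suml.
  rewrite cintegral_sum => [|l]; last first.
    by apply: LinftyM => //; apply: Linfty_conj; exact: Linfty_expk.
  apply: eq_bigr => l _; rewrite -/(fourier _ _) fourierZ ?fourier_expk//.
  exact: Linfty_expk.
rewrite vp_operatorE /trigo_poly.
under eq_bigr do rewrite fT mulr_sumr mulr_suml.
rewrite exchange_big/=; apply: eq_bigr => l _.
have [lD|lD] := pselect (cube d D l).
  have [g gl] := cube_box lD.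
  rewrite (bigD1 g)//= gl eqxx mulr1 big1 ?addr0 1?mulrC// => h hg.
    by rewrite -gl (inj_eq (@box_inj d D)) eq_sym (negbTE hg) mulr0 mulr0 mul0r.
rewrite vp_weight_out// !mul0r big1// => g _.
case: eqP => [lg|_]; last by rewrite mulr0 mulr0 mul0r.
by case: lD; rewrite lg; exact: box_cube.
Qed.

(* Up to the factor [(2b+1)^d] the kernel is the product of the Dirichlet kernels
   of orders a and b; AM-GM and Parseval bound its L^1 norm. *)
Lemma vp_operator_le (f : torus R d -> R[i]) (B : R) x :
  Linfty (torus R d) f -> (forall y, cabs (f y) <= B) ->
  cabs (vp_operator M f x) <= 5 / 2 * B.
Proof.
move=> Lf fB.
have B0 : 0 <= B by exact: le_trans (cabs_ge0 _) (fB x).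
set L : R := (2 * b + 1)%:R ^+ d.
have L0 : 0 < L by rewrite exprn_gt0// ltr0n addn1.
have wE k : L * vp_weight k =
    \sum_P \sum_Q (freqD (@box d a P) (@box d b Q) == k)%:R.
  by apply: vp_weight_count; rewrite leq_mul2r leqnSn orbT.
pose Ka t := \sum_P expk (@box d a P) x * conjc (expk (@box d a P) t).
pose Kb t := \sum_Q expk (@box d b Q) x * conjc (expk (@box d b Q) t).
have Lconj k : Linfty (torus R d) (fun t => conjc (expk k t)).
  by apply: Linfty_conj; exact: Linfty_expk.
have Lfe k : Linfty (torus R d) (fun t => f t * conjc (expk k t)) by exact: LinftyM.
have LKa : Linfty (torus R d) Ka by apply: Linfty_sum => P; exact: LinftyZ.
have LKb : Linfty (torus R d) Kb by apply: Linfty_sum => P; exact: LinftyZ.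
have kernel : L%:C%C * vp_operator M f x =
    cintegral (haar R d) (fun t => f t * (Ka t * Kb t)).
  have -> : (fun t => f t * (Ka t * Kb t)) = (fun t =>
      \sum_P \sum_Q (expk (freqD (@box d a P) (@box d b Q)) x *
        (f t * conjc (expk (freqD (@box d a P) (@box d b Q)) t)))).
    apply/funext => t; rewrite /Ka mulr_suml mulr_sumr; apply: eq_bigr => P _.
    rewrite /Kb !mulr_sumr; apply: eq_bigr => Q _.
    by rewrite !expkD rmorphM; ring.
  have LPQ P Q : Linfty (torus R d) (fun t => expk (freqD (@box d a P) (@box d b Q)) x *
        (f t * conjc (expk (freqD (@box d a P) (@box d b Q)) t))).
    exact: LinftyZ (Lfe _).
  rewrite cintegral_sum => [|P]; last exact: Linfty_sum.
  transitivity (\sum_P \sum_Q (fourier f (freqD (@box d a P) (@box d b Q)) *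
      expk (freqD (@box d a P) (@box d b Q)) x)); last first.
    apply: eq_bigr => P _; rewrite cintegral_sum//; apply: eq_bigr => Q _.
    by rewrite (cintegralZ _ _ (Lfe _)) mulrC.
  rewrite vp_operatorE mulr_sumr.
  transitivity (\sum_g \sum_P \sum_Q
      ((freqD (@box d a P) (@box d b Q) == @box d D g)%:R *
       (fourier f (@box d D g) * expk (@box d D g) x))).
    apply: eq_bigr => g _; rewrite -[_ * _ * expk _ _]mulrA mulrA -rmorphM wE.
    rewrite rmorph_sum mulr_suml; apply: eq_bigr => P _.
    rewrite rmorph_sum mulr_suml; apply: eq_bigr => Q _.
    by rewrite rmorph_nat.
  rewrite exchange_big/=; apply: eq_bigr => P _.
  rewrite exchange_big/=; apply: eq_bigr => Q _.
  have [g gPQ] : exists g, @box d D g = freqD (@box d a P) (@box d b Q).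
    apply: cube_box => i; rewrite !ffunE; have := ltn_ord (P i); have := ltn_ord (Q i).
    by rewrite /D /a /b; nia.
  rewrite (bigD1 g)//= gPQ eqxx mul1r big1 ?addr0// => h hg.
  by rewrite -gPQ (inj_eq (@box_inj d D)) eq_sym (negbTE hg) mul0r.
rewrite -(ler_pM2l L0) -[X in X * cabs _]ger0_norm ?(ltW L0)// -cabs_real -cabsM kernel.
have conj_tpoly m (Km := fun t => \sum_(P : {ffun 'I_d -> 'I_(2 * m + 1)})
    expk (@box d m P) x * conjc (expk (@box d m P) t)) t :
    Km t = conjc (tpoly (@box d m) (fun P => conjc (expk (@box d m P) x)) t).
  rewrite /tpoly rmorph_sum; apply: eq_bigr => P _.
  by rewrite rmorphM; congr (_ * _); apply/esym; exact: conjcK.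
have energy m : \int[haar R d]_t cabs (tpoly (@box d m) (fun P => conjc (expk (@box d m P) x)) t) ^+ 2
    = (2 * m + 1)%:R ^+ d.
  rewrite parseval; last exact: box_inj.
  under eq_bigr do rewrite cabs_conj cabs_expk expr1n.
  by rewrite sumr_const card_ffun !card_ord natrX.
pose psi t := B / 2 *
  (cabs (tpoly (@box d a) (fun P => conjc (expk (@box d a P) x)) t) ^+ 2 +
   cabs (tpoly (@box d b) (fun P => conjc (expk (@box d b P) x)) t) ^+ 2).
have bm m : bounded_measurable (fun t =>
    cabs (tpoly (@box d m) (fun P => conjc (expk (@box d m P) x)) t) ^+ 2).
  by apply: bounded_measurable_cabs2; exact: Linfty_tpoly.
have bpsi : bounded_measurable psi.
  exact: (bounded_measurableM (bounded_measurable_cst _ (B / 2))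
    (bounded_measurableD (bm a) (bm b))).
apply: (@le_trans _ _ (\int[haar R d]_t psi t)).
  apply: cabs_cintegral_le => //; first by apply: LinftyM => //; exact: LinftyM.
  move=> t; rewrite /psi !cabsM /Ka /Kb !conj_tpoly !cabs_conj.
  set u := cabs (tpoly _ _ _); set v := cabs (tpoly _ _ _).
  have uv : u * v <= (u ^+ 2 + v ^+ 2) / 2 by have := sqr_ge0 (u - v); nra.
  have u0 : 0 <= u by exact: cabs_ge0.
  have v0 : 0 <= v by exact: cabs_ge0.
  apply: le_trans (_ : _ <= B * ((u ^+ 2 + v ^+ 2) / 2)) _; last by lra.
  by rewrite ler_pM ?cabs_ge0 ?mulr_ge0.
rewrite /psi RintegralZl//; last first.
  by apply: bounded_measurable_integrable; exact: bounded_measurableD.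
rewrite RintegralD//; [|exact: bounded_measurable_integrable..].
rewrite !energy -/L.
(* The two kernels have energies (2a+1)^d <= 4 L and (2b+1)^d = L; half their sum, by AM-GM, is at
   most 5/2 L. *)
have : (2 * a + 1)%:R ^+ d <= 4 * L by exact: vp_ratio.
by move=> /(ler_wpM2l B0); lra.
Qed.

End vallee_poussin.



(** * Orthogonality on the grid *)

Section grid_orthogonality.
Variable R : realType.

Definition cis (t : R) : R[i] := Complex (cos t) (sin t).

Lemma cisD s t : cis (s + t) = cis s * cis t.
Proof.
by apply/eqP; rewrite /cis cosD sinD eq_complex cReM cImM/= eqxx addrC eqxx.
Qed.

Lemma cis0 : cis 0 = 1.
Proof. by rewrite /cis cos0 sin0. Qed.

Lemma cis_sum (I : Type) (r : seq I) (F : I -> R) :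
  cis (\sum_(i <- r) F i) = \prod_(i <- r) cis (F i).
Proof. exact: (big_morph cis cisD cis0). Qed.

Lemma cisMn t n : cis (n%:R * t) = cis t ^+ n.
Proof.
elim: n => [|n IH]; first by rewrite mul0r cis0.
by rewrite exprS -IH -cisD -[n.+1%:R]natr1 mulrDl mul1r addrC.
Qed.

(** A geometric sum: z^L = 1, while 0 < |q| < L keeps z away from 1. *)
Lemma sum_root_of_unity (L : nat) (q : int) : q != 0 -> (`|q| < L)%N ->
  \sum_(y < L) cis (2 * pi * (q%:~R * (y%:R / L%:R))) = 0.
Proof.
move=> q0 qL; have L0 : 0 < L%:R :> R by rewrite ltr0n; lia.
pose z := cis (2 * pi * (q%:~R / L%:R)).
have zy (y : 'I_L) : cis (2 * pi * (q%:~R * (y%:R / L%:R))) = z ^+ y.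
  rewrite /z -cisMn; congr cis; ring.
rewrite (eq_bigr _ (fun y _ => zy y)).
have zL : z ^+ L = 1.
  rewrite /z -cisMn.
  have -> : L%:R * (2 * pi * (q%:~R / L%:R)) = 2 * pi * q%:~R + 0 :> R.
    by field; rewrite lt0r_neq0.
  by rewrite /cis cosDint sinDint cos0 sin0.
(* If z = 1, the double angle formula gives sin t = 0 for t = pi q / L, although 0 < |t| < pi. *)
have z1 : z != 1.
  apply/eqP => /(congr1 (@complex.Re R)) /=.
  set t : R := pi * (q%:~R / L%:R).
  have -> : 2 * pi * (q%:~R / L%:R) = t *+ 2 by rewrite -[RHS]mulr_natl /t mulrA.
  rewrite cos_mulr2n => c1; have {c1} : sin t ^+ 2 = 0.
    by have := cos2Dsin2 t; move: c1; rewrite -mulr_natl; lra.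
  move=> /eqP; rewrite sqrf_eq0; apply/negP.
  have main (s : R) : 0 < s < 1 -> sin (pi * s) != 0.
    move=> /andP[s0 s1]; rewrite gt_eqF// sin_gt0_pi// mulr_gt0 ?pi_gt0//=.
    by rewrite gtr_pMr ?pi_gt0.
  have [qp|qn] := ltP 0 q.
    apply: main; rewrite divr_gt0 ?ltr0z//= ltr_pdivrMr// mul1r.
    by rewrite -[L%:R]/(L%:Z%:~R) ltr_int; lia.
  have -> : t = - (pi * ((- q)%:~R / L%:R)) by rewrite /t mulrNz mulNr mulrN opprK.
  rewrite sinN oppr_eq0; apply: main; rewrite divr_gt0 ?ltr0z//=; last by lia.
  rewrite ltr_pdivrMr// mul1r -[L%:R]/(L%:Z%:~R) ltr_int; lia.
have := subrX1 z L; rewrite zL subrr => /esym/eqP.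
by rewrite mulf_eq0 subr_eq0 (negbTE z1)/= => /eqP.
Qed.

Variables d D : nat.
Notation G := {ffun 'I_d -> 'I_(2 * D + 1)}.

Definition grid_exp (j x : G) : R[i] := expk (box j) (grid_point R x).

(** The bound 2D is what differences of two frequencies of the cube satisfy: with 2D + 1 points per
    direction they are not aliased, and the exponentials stay orthogonal on the grid. *)
Lemma sum_grid_expk (k : freq d) : (forall i, (`|k i| < 2 * D + 1)%N) ->
  \sum_(x : G) expk k (grid_point R x) = #|{: G}|%:R * (k == [ffun=> 0])%:R.
Proof.
move=> kD.
have factor (x : G) : expk k (grid_point R x) =
    \prod_i cis (2 * pi * ((k i)%:~R * ((x i)%:R / (2 * D + 1)%:R))).
  rewrite /expk -/(cis _) mulr_sumr cis_sum; apply: eq_bigr => i _.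
  by rewrite tnth_mktuple.
rewrite (eq_bigr _ (fun x _ => factor x)).
rewrite -(bigA_distr_bigA (fun i (y : 'I_(2 * D + 1)) =>
  cis (2 * pi * ((k i)%:~R * (y%:R / (2 * D + 1)%:R))))).
have [->|k0] := eqVneq k [ffun=> 0].
  rewrite mulr1 card_ffun !card_ord natrX -[d in _ ^+ d]card_ord -prodr_const.
  apply: eq_bigr => i _; rewrite ffunE.
  under eq_bigr do rewrite mul0r mulr0 cis0.
  by rewrite sumr_const card_ord.
rewrite mulr0; have [i ki] : exists i, k i != 0.
  apply/not_existsP => nk; move/eqP: k0; apply; apply/ffunP => i; rewrite ffunE.
  by apply/eqP/negPn/negP/nk.
by rewrite (bigD1 i)//= sum_root_of_unity ?mul0r.
Qed.

Lemma grid_parseval (h : G -> R[i]) :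
  \sum_x #|{: G}|%:R^-1 * cabs (synthesis grid_exp h x) ^+ 2 =
  \sum_j cabs (h j) ^+ 2.
Proof.
have G0 : #|{: G}|%:R != 0 :> R.
  by rewrite pnatr_eq0 card_ffun !card_ord -lt0n expn_gt0 addn1.
rewrite -mulr_sumr; apply: (mulfI G0); rewrite mulVKf//.
apply: (@complexI R); rewrite rmorphM !rmorph_sum/=.
under eq_bigr do rewrite -mulc_conjE /synthesis rmorph_sum mulr_suml.
rewrite exchange_big/= mulr_sumr; apply: eq_bigr => j _.
rewrite -mulc_conjE.
transitivity (\sum_l h j * conjc (h l) *
    \sum_(x : G) expk (freqB (box j) (box l)) (grid_point R x)).
  under eq_bigr do rewrite mulr_sumr.
  rewrite exchange_big/=; apply: eq_bigr => l _; rewrite mulr_sumr.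
  apply: eq_bigr => x _; rewrite -expk_subK /grid_exp rmorphM/=; ring.
rewrite (bigD1 j)//= [X in _ + X]big1 ?addr0.
  rewrite sum_grid_expk; last first.
    by move=> i; rewrite !ffunE subrr absz0 addn1.
  have -> : freqB (box j) (box j) = [ffun=> 0].
    by apply/ffunP => i; rewrite !ffunE subrr.
  by rewrite eqxx mulr1 mulrC rmorph_nat.
move=> l lj; rewrite sum_grid_expk; last first.
  move=> i; rewrite !ffunE; have := ltn_ord (j i); have := ltn_ord (l i); lia.
rewrite (_ : (_ == _) = false) ?mulr0 ?mulr0//.
apply/negbTE; apply: contra lj => /eqP/ffunP jl; apply/eqP/(@box_inj d D)/ffunP => i.
by have := jl i; rewrite !ffunE; lia.
Qed.

End grid_orthogonality.



(** * Existence of minimizers *)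

Section complex_continuity.
Variables (R : realType) (T : topologicalType).

Definition ccontinuous (F : T -> R[i]) : Prop :=
  continuous (fun v => complex.Re (F v)) /\ continuous (fun v => complex.Im (F v)).

Lemma continuous_sumr (I : Type) (r : seq I) (f : I -> T -> R) :
  (forall i, continuous (f i)) -> continuous (fun v => \sum_(i <- r) f i v).
Proof.
move=> fc; elim: r => [|i r IH] v.
  by under eq_fun do rewrite big_nil; exact: cvg_cst.
by under eq_fun do rewrite big_cons; apply: cvgD; [exact: fc|exact: IH].
Qed.

Lemma ccontinuous_cst c : ccontinuous (fun=> c).
Proof. by split=> v; exact: cvg_cst. Qed.

Lemma ccontinuousB F G : ccontinuous F -> ccontinuous G ->
  ccontinuous (fun v => F v - G v).
Proof.
move=> [FR FI] [GR GI]; split=> v.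
  by under eq_fun do rewrite cReD cReN; apply: cvgB; [exact: FR|exact: GR].
by under eq_fun do rewrite cImD cImN; apply: cvgB; [exact: FI|exact: GI].
Qed.

Lemma ccontinuousZ c F : ccontinuous F -> ccontinuous (fun v => c * F v).
Proof.
move=> [FR FI]; split=> v.
  under eq_fun do rewrite cReM.
  by apply: cvgB; apply: cvgM; (exact: cvg_cst) || (exact: FR) || (exact: FI).
under eq_fun do rewrite cImM.
by apply: cvgD; apply: cvgM; (exact: cvg_cst) || (exact: FR) || (exact: FI).
Qed.

Lemma ccontinuous_sum (I : Type) (r : seq I) (F : I -> T -> R[i]) :
  (forall i, ccontinuous (F i)) -> ccontinuous (fun v => \sum_(i <- r) F i v).
Proof.
move=> Fc; split.
  under eq_fun do rewrite cRe_sum.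
  by apply: continuous_sumr => i; case: (Fc i).
under eq_fun do rewrite cIm_sum.
by apply: continuous_sumr => i; case: (Fc i).
Qed.

Lemma continuous_cabs F : ccontinuous F -> continuous (fun v => cabs (F v)).
Proof.
move=> [FR FI].
have -> : (fun v => cabs (F v)) = Num.sqrt \o
    (fun v => complex.Re (F v) * complex.Re (F v) + complex.Im (F v) * complex.Im (F v)).
  by apply/funext => v /=; rewrite -!expr2 -cabs_sqr sqrtr_sqr ger0_norm ?cabs_ge0.
move=> v; apply: continuous_comp; last exact: sqrt_continuous.
by apply: cvgD; apply: cvgM; (exact: FR) || (exact: FI).
Qed.

End complex_continuity.

Section finite_minimization.
Variables (R : realType) (G : finType).
Let p := #|{: G * bool}|.

(** Complex vectors become real row vectors with two coordinates per index, where products of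
    segments are compact and the extreme value theorem applies. *)
Definition vec_of (z : G -> R[i]) : 'rV[R]_p :=
  \row_i let gb := enum_val i in
    if gb.2 then complex.Im (z gb.1) else complex.Re (z gb.1).

Definition of_vec (v : 'rV[R]_p) (g : G) : R[i] :=
  Complex (v ord0 (enum_rank (g, false))) (v ord0 (enum_rank (g, true))).

Lemma vec_ofK z : of_vec (vec_of z) = z.
Proof.
by apply/funext => g; rewrite /of_vec !mxE !enum_rankK /=; case: (z g).
Qed.

Lemma ccontinuous_of_vec g : ccontinuous (fun v => of_vec v g).
Proof. by split=> v; exact: coord_continuous. Qed.

(** [psi] is a constraint and [phi] the objective. It is used with the residual in either role: as
    constraint for the l1 problem, as objective for the choice of an exactly feasible sparse
    vector. *)
Lemma box_minimizer (B c : R) (psi phi : (G -> R[i]) -> R) (z0 : G -> R[i]) :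
  continuous (psi \o of_vec) -> continuous (phi \o of_vec) ->
  psi z0 <= c -> (forall g, cabs (z0 g) <= B) ->
  exists2 z, psi z <= c &
    forall z', psi z' <= c -> (forall g, cabs (z' g) <= B) -> phi z <= phi z'.
Proof.
move=> psic phic pz0 z0B.
pose A := [set v : 'rV[R]_p | forall i, `[- B, B]%classic (v ord0 i)] `&`
  ((psi \o of_vec) @^-1` [set x | x <= c]).
have inA z : psi z <= c -> (forall g, cabs (z g) <= B) -> A (vec_of z).
  move=> pz zB; split; last by rewrite /= vec_ofK.
  move=> i /=; rewrite mxE in_itv/= -ler_norml; apply: le_trans (zB (enum_val i).1).
  by case: ifP => _; [exact: normr_Im_le|exact: normr_Re_le].
have [] := @EVT_min_rV R p (phi \o of_vec) A.
- by exists (vec_of z0); exact: inA.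
- apply: compact_closedI; last by apply: preimage_closed => //; exact: closed_le.
  exact: (@rV_compact R p (fun=> `[- B, B]%classic) (fun=> @segment_compact R (- B) B)).
- exact: continuous_subspaceT.
move=> v; rewrite inE => -[_ pv] vmin; exists (of_vec v) => // z' pz' z'B.
by have := vmin (vec_of z'); rewrite /= vec_ofK; apply; rewrite inE; exact: inA.
Qed.

Variables (m : nat) (E : 'I_m -> G -> R[i]) (y : 'I_m -> R[i]).

Definition residual (z : G -> R[i]) : R :=
  Num.sqrt (\sum_(l < m) cabs (\sum_g E l g * z g - y l) ^+ 2).

Lemma continuous_residual : continuous (residual \o of_vec).
Proof.
move=> v; apply: continuous_comp; last exact: sqrt_continuous.
apply: continuous_sumr => l w; under eq_fun do rewrite expr2.
have c : continuous (fun w => cabs (\sum_g E l g * of_vec w g - y l)).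
  apply: continuous_cabs; apply: ccontinuousB; last exact: ccontinuous_cst.
  by apply: ccontinuous_sum => g; apply: ccontinuousZ; exact: ccontinuous_of_vec.
exact: (@continuousM R _ _ _ w (c w) (c w)).
Qed.

Lemma l1_minimizer_exists (eps : R) (z0 : G -> R[i]) : residual z0 <= eps ->
  exists2 z, residual z <= eps &
    forall z', residual z' <= eps -> \sum_g cabs (z g) <= \sum_g cabs (z' g).
Proof.
move=> rz0.
have cl1 : continuous ((fun z => \sum_g cabs (z g)) \o of_vec).
  by apply: continuous_sumr => g; apply: continuous_cabs; exact: ccontinuous_of_vec.
have coord (z : G -> R[i]) g : cabs (z g) <= \sum_g cabs (z g).
  by rewrite (bigD1 g)//= lerDl sumr_ge0// => *; exact: cabs_ge0.
have [z rz zmin] := box_minimizer continuous_residual cl1 rz0 (coord z0).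
exists z => // z' rz'.
(* A competitor of l1 norm larger than that of [z0] may leave the compact box, but then it loses to
   [z0], which lies inside. *)
have [z'z0|z0z'] := leP (\sum_g cabs (z' g)) (\sum_g cabs (z0 g)).
  by apply: zmin => // g; exact: le_trans (coord z' g) z'z0.
exact: le_trans (zmin z0 rz0 (coord z0)) (ltW z0z').
Qed.

(** For each support the residual attains a minimum over vectors bounded by B, and there are
    finitely many supports. The best of these minima is below eps + delta for every delta; the bound
    B, uniform in delta, supplies the compactness. *)
Lemma sparse_exact (n : nat) (B eps : R) : 0 <= B ->
  (forall delta, 0 < delta -> exists S : {set G}, exists z : G -> R[i],
    [/\ (#|S| <= n)%N, forall g, g \notin S -> z g = 0,
        forall g, cabs (z g) <= B & residual z <= eps + delta]) ->
  exists S : {set G}, exists z : G -> R[i],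
    [/\ (#|S| <= n)%N, forall g, g \notin S -> z g = 0 & residual z <= eps].
Proof.
move=> B0 approx.
(* The support condition is encoded as [off S z <= 0], a closed scalar constraint of the form that
   [box_minimizer] accepts. *)
pose off (S : {set G}) (z : G -> R[i]) : R := \sum_(g | g \notin S) cabs (z g).
have offP S z : off S z <= 0 <-> forall g, g \notin S -> z g = 0.
  split=> [z0 g gS|z0]; last by rewrite /off big1// => g gS; rewrite z0// cabs0.
  have off0 : off S z = 0.
    by apply/eqP; rewrite eq_le z0 sumr_ge0// => *; exact: cabs_ge0.
  apply: ComplexField.Normc.eq0_normc.
  exact: (psumr_eq0P (fun g _ => cabs_ge0 (z g)) off0).
have coff S : continuous (off S \o of_vec).
  have -> : off S \o of_vec = fun v => \sum_(g <- enum (~: S)) cabs (of_vec v g).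
    by apply/funext => v; rewrite /= /off big_enum/=; apply: eq_bigl => g; rewrite inE.
  by apply: continuous_sumr => g; apply: continuous_cabs; exact: ccontinuous_of_vec.
have /choice[zS zSP] : forall S : {set G}, exists z : G -> R[i], off S z <= 0 /\
    forall z', off S z' <= 0 -> (forall g, cabs (z' g) <= B) ->
      residual z <= residual z'.
  move=> S; have [||z h1 h2] := @box_minimizer B 0 (off S) residual (fun=> 0)
      (coff S) continuous_residual.
  - by apply/offP.
  - by move=> g; rewrite cabs0.
  - by exists z.
have n0 : (#|finset.set0 : {set G}| <= n)%N by rewrite cards0.
have [S Sn Smin] := @arg_minP _ R {set G} finset.set0 (fun S => #|S| <= n)%N
  (fun S => residual (zS S)) n0.
have [zS0 _] := zSP S.
exists S, (zS S); split=> //; first exact/offP.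
apply/ler_addgt0Pr => delta delta0.
have [S' [z [S'n zS' zB rz]]] := approx delta delta0.
apply: le_trans rz; apply: le_trans (Smin S' S'n) _.
by have [_ h] := zSP S'; apply: h => //; exact/offP.
Qed.

End finite_minimization.



Lemma L2norm_le (R : realType) (d : nat) (h : torus R d -> R[i]) (r : R) :
  Linfty (torus R d) h -> 0 <= r ->
  \int[haar R d]_x cabs (h x) ^+ 2 <= r ^+ 2 -> (L2norm h <= r%:E)%E.
Proof.
move=> Lh r0 hr; rewrite /L2norm unlock.
have -> : (\int[haar R d]_x (`|(cabs (h x))%:E| `^ 2))%E =
    (\int[haar R d]_x cabs (h x) ^+ 2)%R%:E.
  rewrite /Rintegral fineK; last first.
    apply: integrable_fin_num => //.
    by apply: bounded_measurable_integrable; exact: bounded_measurable_cabs2.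
  apply: eq_integral => x _; rewrite abse_EFin ger0_norm ?cabs_ge0//.
  by rewrite poweR_EFin -[2]/(2%:R) powR_mulrn ?cabs_ge0.
rewrite poweR_EFin lee_fin powR12_sqrt; last first.
  by apply: Rintegral_ge0 => x _; exact: sqr_ge0.
by rewrite -[leRHS]ger0_norm// -sqrtr_sqr ler_wsqrtr.
Qed.

(** * Recovery by l1-minimization *)

Section sparse_recovery.
Variables (R : realType) (G : finType).

Lemma cauchy_schwarz_card (S : {set G}) (a : G -> R) :
  (\sum_(g in S) a g) ^+ 2 <= #|S|%:R * \sum_(g in S) a g ^+ 2.
Proof.
set T := \sum_(g in S) a g.
have [S0|S0] := posnP #|S|.
  rewrite /T (eq_bigl pred0) ?big_pred0_eq ?expr0n ?S0 ?mul0r// => g.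
  exact: (card0_eq S0).
have : 0 <= \sum_(g in S) (#|S|%:R * a g - T) ^+ 2.
  by apply: sumr_ge0 => g _; exact: sqr_ge0.
rewrite (eq_bigr (fun g => #|S|%:R ^+ 2 * a g ^+ 2 - 2 * #|S|%:R * T * a g + T ^+ 2)).
  rewrite big_split/= sumrB sumr_const -!mulr_sumr -/T -(mulr_natl (T ^+ 2)).
  have S0' : 0 < #|S|%:R :> R by rewrite ltr0n.
  move=> h; rewrite -(ler_pM2l S0'); move: h; set Q := \sum_(g in S) _; lra.
by move=> g _; ring.
Qed.

(** The sparsity is 2n because this is applied to a difference of two n-sparse vectors;
    Cauchy-Schwarz gives the factor 2n, within the 4n of the cone. *)
Lemma sparse_cone (n : nat) (S : {set G}) (h : G -> R[i]) :
  (#|S| <= 2 * n)%N -> (forall g, g \notin S -> h g = 0) ->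
  (\sum_g cabs (h g)) ^+ 2 <= 4 * n%:R * \sum_g cabs (h g) ^+ 2.
Proof.
move=> Sn hS.
have onS k : (0 < k)%N -> \sum_g cabs (h g) ^+ k = \sum_(g in S) cabs (h g) ^+ k.
  move=> k0; rewrite (bigID (mem S))/= [X in _ + X]big1 ?addr0// => g gS.
  by rewrite hS// cabs0 expr0n gtn_eqF.
have := cauchy_schwarz_card S (fun g => cabs (h g)).
have := onS 1%N isT; rewrite (eq_bigr _ (fun g _ => expr1 (cabs (h g)))) => ->.
rewrite (eq_bigr _ (fun g _ => expr1 (cabs (h g)))) onS// => /le_trans; apply.
rewrite ler_wpM2r//; first by apply: sumr_ge0 => g _; exact: sqr_ge0.
by rewrite -natrM ler_nat; lia.
Qed.

(** Off S the error equals x, and minimality makes its l1 mass there at most the mass of the error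
    on S. So the total is at most twice the mass on S, and Cauchy-Schwarz on S gives 4 n. *)
Lemma minimizer_cone (n : nat) (S : {set G}) (x z : G -> R[i]) :
  (#|S| <= n)%N -> (forall g, g \notin S -> z g = 0) ->
  \sum_g cabs (x g) <= \sum_g cabs (z g) ->
  (\sum_g cabs (x g - z g)) ^+ 2 <= 4 * n%:R * \sum_g cabs (x g - z g) ^+ 2.
Proof.
move=> Sn zS xz; set a := fun g => cabs (x g - z g).
have a0 g : 0 <= a g by exact: cabs_ge0.
have half : \sum_g a g <= 2 * \sum_(g in S) a g.
  have offS : \sum_(g | g \notin S) a g = \sum_(g | g \notin S) cabs (x g).
    by apply: eq_bigr => g gS; rewrite /a zS// subr0.
  have onS : \sum_(g in S) cabs (z g) <= \sum_(g in S) (a g + cabs (x g)).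
    apply: ler_sum => g _; rewrite /a cabsB.
    by have := cabsD (z g - x g) (x g); rewrite subrK.
  have z0 : \sum_(g | g \notin S) cabs (z g) = 0.
    by rewrite big1// => g gS; rewrite zS// cabs0.
  move: xz; rewrite (bigID (mem S))/= [leRHS](bigID (mem S))/= z0 => xz'.
  rewrite [X in X <= _](bigID (mem S))/= offS; move: onS; rewrite big_split/=; lra.
have aS0 : 0 <= \sum_(g in S) a g by exact: sumr_ge0.
have aT0 : 0 <= \sum_g a g by exact: sumr_ge0.
apply: (@le_trans _ _ ((2 * \sum_(g in S) a g) ^+ 2)).
  by rewrite lerXn2r// nnegrE mulr_ge0.
rewrite exprMn -mulrA (_ : 2 ^+ 2 = 4); last by ring.
rewrite ler_pM2l//; apply: le_trans (cauchy_schwarz_card S a) _.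
rewrite ler_pM ?ler_nat ?sumr_ge0// => [g _|]; first exact: sqr_ge0.
rewrite [leRHS](bigID (mem S))/= lerDl sumr_ge0// => g _; exact: sqr_ge0.
Qed.

Lemma sqr_cabsB (p q : R[i]) : cabs (p - q) ^+ 2 <= 2 * cabs p ^+ 2 + 2 * cabs q ^+ 2.
Proof.
have := cabsD p (- q); rewrite cabsN => h.
have : cabs (p - q) ^+ 2 <= (cabs p + cabs q) ^+ 2.
  by rewrite lerXn2r// nnegrE ?addr_ge0 ?cabs_ge0.
have := sqr_ge0 (cabs p - cabs q); nra.
Qed.

Variables (X : finType) (e : G -> X -> R[i]) (m n : nat) (u : 'I_m -> X).
Hypothesis m_gt0 : (0 < m)%N.
Hypothesis eigenvalue : forall h : G -> R[i],
  (\sum_g cabs (h g)) ^+ 2 <= 4 * n%:R * \sum_g cabs (h g) ^+ 2 ->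
  \sum_g cabs (h g) ^+ 2 <=
    2 ^+ 9 * (m%:R^-1 * \sum_l cabs (synthesis e h (u l)) ^+ 2).

Let res := residual (fun l g => e g (u l)).

Lemma residual_difference (y : 'I_m -> R[i]) (z1 z2 : G -> R[i]) (r1 r2 : R) :
  0 <= r1 -> 0 <= r2 ->
  res y z1 <= r1 * Num.sqrt m%:R -> res y z2 <= r2 * Num.sqrt m%:R ->
  m%:R^-1 * \sum_l cabs (synthesis e (fun g => z1 g - z2 g) (u l)) ^+ 2 <=
  2 * (r1 ^+ 2 + r2 ^+ 2).
Proof.
have m0 : 0 < m%:R :> R by rewrite ltr0n.
have sq z r : 0 <= r -> res y z <= r * Num.sqrt m%:R ->
    \sum_(l < m) cabs (\sum_g e g (u l) * z g - y l) ^+ 2 <= r ^+ 2 * m%:R.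
  move=> r0 rz; set s := \sum_(l < m) _.
  have s0 : 0 <= s by apply: sumr_ge0 => l _; exact: sqr_ge0.
  rewrite -(sqr_sqrtr s0) -[X in _ * X](sqr_sqrtr (ltW m0)) -exprMn.
  by rewrite lerXn2r// nnegrE ?mulr_ge0 ?sqrtr_ge0.
move=> r10 r20 /(sq _ _ r10) h1 /(sq _ _ r20) h2.
rewrite ler_pdivrMl//.
apply: (@le_trans _ _ (2 * (r1 ^+ 2 * m%:R) + 2 * (r2 ^+ 2 * m%:R))); last by lra.
apply: le_trans (lerD (ler_wpM2l _ h1) (ler_wpM2l _ h2)) => //.
rewrite !mulr_sumr -big_split/=; apply: ler_sum => l _.
apply: le_trans (sqr_cabsB _ _).
rewrite le_eqVlt; apply/orP; left; apply/eqP; congr (cabs _ ^+ 2).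
rewrite /synthesis opprB addrA subrK -sumrB.
by apply: eq_bigr => g _; rewrite mulrBl ![e _ _ * _]mulrC.
Qed.

(* [z] is an exactly feasible sparse vector, [z'] a sparse vector close to the
   target in the supremum norm; [x] is compared with [z'] through [z]. *)
Lemma l1_recovery (y : 'I_m -> R[i]) (x z z' : G -> R[i]) (S S' : {set G})
    (eta eta' : R) :
  0 <= eta <= eta' ->
  (#|S| <= n)%N -> (forall g, g \notin S -> z g = 0) ->
  res y z <= eta * Num.sqrt m%:R ->
  res y x <= eta * Num.sqrt m%:R -> \sum_g cabs (x g) <= \sum_g cabs (z g) ->
  (#|S'| <= n)%N -> (forall g, g \notin S' -> z' g = 0) ->
  res y z' <= eta' * Num.sqrt m%:R ->
  \sum_g cabs (z' g - x g) ^+ 2 <= 2 ^+ 13 * eta' ^+ 2.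
Proof.
move=> /andP[e0 ee'] Sn zS rz rx xz S'n z'S rz'.
have e'0 : 0 <= eta' by exact: le_trans ee'.
have h1 := eigenvalue (minimizer_cone Sn zS xz).
have h2 : \sum_g cabs (z' g - z g) ^+ 2 <= 2 ^+ 9 *
    (m%:R^-1 * \sum_l cabs (synthesis e (fun g => z' g - z g) (u l)) ^+ 2).
  apply: eigenvalue; apply: (@sparse_cone n (S :|: S')).
    by rewrite (leq_trans (leq_card_setU _ _))// mul2n -addnn leq_add.
  by move=> g; rewrite inE negb_or => /andP[gS gS']; rewrite zS// z'S// subr0.
have k1 := residual_difference e0 e0 rx rz.
have k2 := residual_difference e'0 e0 rz' rz.
have ee2 : eta ^+ 2 <= eta' ^+ 2 by rewrite lerXn2r// nnegrE.
apply: (@le_trans _ _ (2 * (\sum_g cabs (z' g - z g) ^+ 2) +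
    2 * (\sum_g cabs (x g - z g) ^+ 2))).
  rewrite !mulr_sumr -big_split/=; apply: ler_sum => g _.
  apply: le_trans (sqr_cabsB _ _); rewrite le_eqVlt; apply/orP; left; apply/eqP.
  by congr (cabs _ ^+ 2); ring.
have p9 : 0 <= 2 ^+ 9 :> R by rewrite exprn_ge0.
(* Each of the two squared errors is at most 2^9 * 4 eta'^2, and both enter doubled: 2^9 * 16 =
   2^13. *)
have := le_trans h1 (ler_wpM2l p9 k1); have := le_trans h2 (ler_wpM2l p9 k2).
have -> : 2 ^+ 13 = 2 ^+ 9 * 16 :> R by ring.
have := ler_wpM2l p9 ee2.
move: (2 ^+ 9) => A; lra.
Qed.

End sparse_recovery.



(** * From near-best trigonometric approximants to sparse coefficient vectors *)

Section sup_norms.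
Variable R : realType.

Lemma sup_normP (T : Type) (f : T -> R[i]) (B : \bar R) :
  (sup_norm f <= B)%E <-> forall x, ((cabs (f x))%:E <= B)%E.
Proof.
split=> [fB x|fB]; first by apply: le_trans fB; apply: ereal_sup_ubound; exists x.
by apply: ge_ereal_sup => _ [x _ <-].
Qed.

Variables (d n M : nat).
Hypothesis d_gt0 : (0 < d)%N.

Let x0 : torus R d := [tuple point | i < d].

Lemma sup_norm_ge0 (f : torus R d -> R[i]) : (0 <= sup_norm f)%E.
Proof.
apply: (@le_trans _ _ (cabs (f x0))%:E); first by rewrite lee_fin cabs_ge0.
by apply: ereal_sup_ubound; exists x0.
Qed.

Lemma vp_norm_bounds : (0 <= @vp_norm R d M <= (5 / 2)%:E)%E.
Proof.
apply/andP; split.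
  apply: (@le_trans _ _ (sup_norm (@vp_operator R d M (fun=> 0)))).
    exact: sup_norm_ge0.
  apply: ereal_sup_ubound; exists (fun=> 0) => //; split; first exact: Linfty_cst.
  by apply/sup_normP => x; rewrite cabs0 lee_fin.
apply: ge_ereal_sup => _ [f [Lf /sup_normP f1] <-]; apply/sup_normP => x.
rewrite lee_fin -[leRHS]mulr1; exact: vp_operator_le.
Qed.

Lemma vp_norm_apply (tau : R) (h : torus R d -> R[i]) (B : R) x :
  @vp_norm R d M = tau%:E -> Linfty (torus R d) h ->
  (forall y, cabs (h y) <= B) -> cabs (vp_operator M h x) <= tau * B.
Proof.
move=> tauE Lh hB; have B0 : 0 <= B by exact: le_trans (cabs_ge0 _) (hB x).
(* Normalising h by B^-1 needs B > 0; for B = 0 the explicit bound 5/2 * B already gives zero. *)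
move: B0; rewrite le_eqVlt => /predU1P[B0|B0].
  by have := vp_operator_le M d_gt0 x Lh hB; rewrite -B0 !mulr0.
have Bi : 0 <= B^-1 by rewrite invr_ge0 ltW.
have : ((cabs (vp_operator M (fun y => (B^-1)%:C%C * h y) x))%:E <= tau%:E)%E.
  rewrite -tauE.
  apply: (@le_trans _ _ (sup_norm (vp_operator M (fun y => (B^-1)%:C%C * h y)))).
    by apply: ereal_sup_ubound; exists x.
  apply: ereal_sup_ubound; exists (fun y => (B^-1)%:C%C * h y) => //.
  split; first exact: LinftyZ.
  apply/sup_normP => y; rewrite lee_fin cabsM cabs_real ger0_norm//.
  by rewrite mulrC ler_pdivrMr// mul1r.
rewrite lee_fin vp_operatorZ// cabsM cabs_real ger0_norm//.
by rewrite mulrC ler_pdivrMr.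
Qed.

Variable F : quasiNormedSpace R (torus R d).

Lemma unit_ball0 : unit_ball F (fun=> 0).
Proof.
split; first exact: qcarrier0.
rewrite (_ : qnorm F (fun=> 0) = 0)//.
rewrite -[RHS](mul0r (qnorm F (fun=> 0))) -(cabs0 R) -qnormZ; last exact: qcarrier0.
by congr qnorm; apply/funext => x; rewrite mul0r.
Qed.

Lemma best_nterm_ge0 : (0 <= best_nterm n F)%E.
Proof.
apply: le_trans; last by apply: ereal_sup_ubound; exists (fun=> 0);
  [exact: unit_ball0|reflexivity].
by apply: le_ereal_inf_tmp => _ [A _ [c _ <-]]; exact: sup_norm_ge0.
Qed.

Lemma best_approx_ge0 (J : set (freq d)) : (0 <= best_approx J F)%E.
Proof.
apply: le_trans; last by apply: ereal_sup_ubound; exists (fun=> 0);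
  [exact: unit_ball0|reflexivity].
by apply: le_ereal_inf_tmp => _ [g _ <-]; exact: sup_norm_ge0.
Qed.

Let D := ((2 * d + 1) * M)%N.
Notation G := {ffun 'I_d -> 'I_(2 * D + 1)}.

(** The origin of eta. Let V be the de la Vallee Poussin operator, p a near-best n-term polynomial
    and p' a near-best one from the inner cube, so V p' = p'. Then f - V p = (f - p') - V (f - p') +
    V (f - p), and V p keeps at most n frequencies, all in J*. *)
Lemma sparse_approximant (s t tau delta : R) (f : torus R d -> R[i]) :
  best_nterm n F = s%:E -> best_approx (cube d M) F = t%:E ->
  @vp_norm R d M = tau%:E -> embeds_in_Linfty F -> unit_ball F f -> 0 < delta ->
  exists S : {set G}, exists z : G -> R[i],
    [/\ (#|S| <= n)%N, forall g, g \notin S -> z g = 0 &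
      forall x, cabs (f x - tpoly (@box d D) z x) <=
        tau * s + (1 + tau) * t + (1 + 2 * tau) * delta].
Proof.
move=> sE tE tauE [FL _] Ff delta0; have Lf := FL _ Ff.1.
have [_ [A /= An [c _ <-]] Ac] : exists2 y, [set sup_norm (fun x => f x - trigo_poly A c x) |
      A in [set A : {fset freq d} | (#|` A| <= n)%N] & c in setT] y &
      (y < (s + delta)%:E)%E.
  apply: ereal_inf_lt; apply: (@le_lt_trans _ _ s%:E); last by rewrite lte_fin ltrDl.
  by rewrite -sE; apply: ereal_sup_ubound; exists f.
have [_ [_ [A' /= A'M [c' _ <-]] <-] A'c] : exists2 y,
      [set sup_norm (fun x => f x - g x) | g in trigo_span (cube d M)] y &
      (y < (t + delta)%:E)%E.
  apply: ereal_inf_lt; apply: (@le_lt_trans _ _ t%:E); last by rewrite lte_fin ltrDl.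
  by rewrite -tE; apply: ereal_sup_ubound; exists f.
pose z (g : G) : R[i] := if box g \in A then (vp_weight R M (box g))%:C%C * c (box g) else 0.
exists [set g : G | box g \in A]%SET, z; split.
- rewrite (leq_trans _ An)// cardE -(size_map (@box d D)) uniq_leq_size//.
    by rewrite map_inj_uniq ?enum_uniq//; exact: box_inj.
  by move=> k /mapP[g]; rewrite mem_enum inE => gA ->.
- by move=> g; rewrite inE /z => /negbTE ->.
move=> x.
have zV : tpoly (@box d D) z x = vp_operator M (trigo_poly A c) x.
  rewrite vp_operator_trigo_poly// /trigo_poly /tpoly.
  pose phi k : R[i] := (vp_weight R M k)%:C%C * c k * expk k x.
  transitivity (\sum_(g : G) \sum_(k <- A) if box g == k then phi k else 0).
    apply: eq_bigr => g _; rewrite -big_mkcond/= /z.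
    have [gA|gA] := boolP (box g \in A).
      rewrite (eq_bigl (pred1 (box g))) => [|k]; last by rewrite /= eq_sym.
      by rewrite -big_filter filter_pred1_uniq ?fset_uniq// big_seq1.
    rewrite mul0r big_seq_cond big1// => k /andP[kA /eqP gk].
    by rewrite gk kA in gA.
  rewrite exchange_big/=; apply: eq_bigr => k _; rewrite -/(phi k).
  have [kD|kD] := pselect (cube d D k).
    have [g gk] := cube_box kD.
    rewrite (bigD1 g)//= gk eqxx big1 ?addr0// => h hg.
    by rewrite -gk (inj_eq (@box_inj d D)) (negbTE hg).
  rewrite big1 => [|g _]; last by case: eqP => // gk; case: kD; rewrite -gk; exact: box_cube.
  by rewrite /phi vp_weight_out ?mul0r.
have LA := Linfty_trigo_poly A c; have LA' := Linfty_trigo_poly A' c'.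
have V' : vp_operator M (trigo_poly A' c') x = trigo_poly A' c' x.
  rewrite vp_operator_trigo_poly//; apply: eq_big_seq => k kA'.
  by rewrite vp_weight_in ?mul1r//; exact: A'M.
have bA y : cabs (f y - trigo_poly A c y) <= s + delta.
  by rewrite -lee_fin; move: y; apply/sup_normP/ltW.
have bA' y : cabs (f y - trigo_poly A' c' y) <= t + delta.
  by rewrite -lee_fin; move: y; apply/sup_normP/ltW.
have k1 := vp_norm_apply x tauE (LinftyB Lf LA) bA.
have k2 := vp_norm_apply x tauE (LinftyB Lf LA') bA'.
rewrite vp_operatorB// in k1; rewrite vp_operatorB// V' in k2.
rewrite zV.
have -> : f x - vp_operator M (trigo_poly A c) x = (f x - trigo_poly A' c' x) +
   (- (vp_operator M f x - trigo_poly A' c' x) +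
    (vp_operator M f x - vp_operator M (trigo_poly A c) x)) by ring.
apply: le_trans (cabsD _ _) _; have := bA' x.
have := cabsD (- (vp_operator M f x - trigo_poly A' c' x))
  (vp_operator M f x - vp_operator M (trigo_poly A c) x).
rewrite cabsN; lra.
Qed.

End sup_norms.



(** * Sample size and random points *)

Section constants.
Variable R : realType.

Lemma ln2_bounds : 2^-1 <= ln (2 : R) <= 1.
Proof.
apply/andP; split.
  by rewrite -[leLHS]expRK ler_ln ?posrE ?expR_gt0// expR_half_le2.
by rewrite -[leRHS]expRK ler_ln ?posrE ?expR_gt0//; exact: (expR_ge1Dx 1).
Qed.

Lemma ln_succ_ge_half (n : nat) : (0 < n)%N -> 2^-1 <= ln (n%:R + 1) :> R.
Proof.
move=> n0; have /andP[h _] := ln2_bounds; apply: le_trans h _.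
by rewrite natr1 ler_ln ?posrE// ler_nat.
Qed.

(** One unit rounds the logarithm up and four provide the factor 16 in 16 n <= 2^T. Being at least
    ln(n+1) yields the failure probability, being at most 12 ln(n+1) the sample size. *)
Definition num_levels (n : nat) : nat := trunc_log 2 n + 5.

Lemma num_levels_pow (n : nat) : (16 * n <= 2 ^ num_levels n)%N.
Proof.
by rewrite /num_levels -addSnnS expnD mulnC leq_mul// ltnW// trunc_log_ltn.
Qed.

Lemma ln_le_num_levels (n : nat) : ln (n%:R + 1) <= (num_levels n)%:R :> R.
Proof.
have /andP[_ l1] := ln2_bounds.
apply: (@le_trans _ _ (ln (2 ^+ num_levels n))).
  rewrite ler_ln ?posrE ?exprn_gt0// natr1 ?ltr0n// -natrX ler_nat.
  by have := num_levels_pow n; case: n => [|n]; rewrite ?expn_gt0//; lia.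
by rewrite lnXn// -[leLHS]mulr_natl ler_piMr.
Qed.

Lemma num_levels_le_ln (n : nat) : (0 < n)%N ->
  (num_levels n)%:R <= 12 * ln (n%:R + 1) :> R.
Proof.
move=> n0; have /andP[l2 _] := ln2_bounds; have := ln_succ_ge_half n0.
have : (trunc_log 2 n)%:R * ln 2 <= ln (n%:R + 1) :> R.
  rewrite mulr_natl -lnXn// ler_ln ?posrE ?exprn_gt0// natr1 ?ltr0n//.
  by rewrite -natrX ler_nat (leq_trans (trunc_logP _ n0)).
have : 0 <= (trunc_log 2 n)%:R * (ln 2 - 2^-1) :> R by rewrite mulr_ge0// subr_ge0.
rewrite /num_levels natrD; lra.
Qed.

Variables (d M : nat).
Hypotheses (d_gt0 : (0 < d)%N) (M_ge3 : (3 <= M)%N).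

Let b := (2 * ((2 * d + 1) * M) + 1)%N.

Let b_ge : (19 <= b)%N.
Proof. by rewrite /b; have : (3 * 3 <= (2 * d + 1) * M)%N by [apply: leq_mul; lia]; lia. Qed.

Lemma grid_card_ge : (19 <= b ^ d)%N.
Proof. by rewrite (leq_trans b_ge)// -[leqLHS]expn1 leq_pexp2l//; lia. Qed.

Lemma ln_grid_card_ge1 : 1 <= ln ((b ^ d)%:R : R).
Proof.
have N0 : 0 < (b ^ d)%:R :> R by rewrite ltr0n; have := grid_card_ge; lia.
rewrite -[leLHS]expRK ler_ln ?posrE ?expR_gt0//.
apply: le_trans (expR1_le4 R) _; rewrite ler_nat.
by have := grid_card_ge; lia.
Qed.

Lemma grid_dictionary_le : (4 * b ^ d + 1)%:R <= expR (2 * ln ((b ^ d)%:R : R)).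
Proof.
have N0 : 0 < (b ^ d)%:R :> R by rewrite ltr0n; have := grid_card_ge; lia.
rewrite expRM_natl lnK ?posrE// -natrX ler_nat.
by have := grid_card_ge; move: (b ^ d)%N => N; nia.
Qed.

(** Since b <= 8 d M, ln b is at most 4 ln(d+1) + ln M; both ln(d+1) and ln M are at least 1/2, so
    this is at most (8 + 2) ln(d+1) ln M. *)
Lemma ln_grid_card_le :
  ln ((b ^ d)%:R : R) <= 10 * (d%:R * ln (d%:R + 1) * ln M%:R).
Proof.
have b0 : 0 < b%:R :> R by rewrite ltr0n; lia.
rewrite natrX lnXn// -[leLHS]mulr_natl -mulrA mulrCA ler_wpM2l//.
have M0 : 0 < M%:R :> R by rewrite ltr0n; lia.
have d0 : 0 < d%:R :> R by rewrite ltr0n.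
have /andP[l2 _] := ln2_bounds.
have a1 := ln_succ_ge_half d_gt0.
have a2 : ln 2 <= ln (d%:R + 1) :> R by rewrite natr1 ler_ln ?posrE// ler_nat.
have a3 : ln d%:R <= ln (d%:R + 1) :> R by rewrite natr1 ler_ln ?posrE ?ltr0n// ler_nat.
have a4 : 2^-1 <= ln M%:R :> R.
  by apply: le_trans l2 _; rewrite ler_ln ?posrE// ler_nat; lia.
have : ln (b%:R : R) <= 3 * ln 2 + ln d%:R + ln M%:R.
  have -> : 3 * ln 2 = ln (2 ^+ 3 : R) by rewrite lnXn// -[RHS]mulr_natl.
  rewrite -!lnM ?posrE ?mulr_gt0 ?exprn_gt0// ler_ln ?posrE ?mulr_gt0 ?exprn_gt0//.
  rewrite -natrX -!natrM ler_nat /b -[(2 ^ 3)%N]/8%N.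
  by have : (M <= d * M)%N by [rewrite leq_pmull]; lia.
have p1 : 0 <= (ln (d%:R + 1) - 2^-1) * (ln M%:R - 2^-1) :> R.
  by rewrite mulr_ge0// subr_ge0.
have p2 : 0 <= ln (d%:R + 1) * (ln M%:R - 2^-1) :> R.
  by rewrite mulr_ge0 ?subr_ge0//; lra.
have p3 : 0 <= (ln (d%:R + 1) - 2^-1) * ln M%:R :> R.
  by rewrite mulr_ge0 ?subr_ge0//; lra.
lra.
Qed.

(** The losses 12^2 for the number of levels and 10 for ln N multiply to 1440 <= 2^11, which turns
    2^29 into 2^40. *)
Lemma sample_size_le (n : nat) : (0 < n)%N ->
  2 ^+ 29 * n%:R * (num_levels n)%:R ^+ 2 * ln ((b ^ d)%:R) <=
  (`|Num.ceil (2 ^+ 40 * d%:R * ln (d%:R + 1) * n%:R *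
       ln (n%:R + 1) ^+ 2 * ln M%:R : R)|%N)%:R :> R.
Proof.
move=> n0; set x := (X in Num.ceil X).
have a1 := ln_succ_ge_half d_gt0; have a2 := ln_succ_ge_half n0.
have a3 : 0 <= ln M%:R :> R by rewrite ln_ge0// ler1n; lia.
have x0 : 0 <= x by rewrite /x !mulr_ge0 ?exprn_ge0//; lra.
have -> : (`|Num.ceil x|%N)%:R = (Num.ceil x)%:~R :> R.
  have : 0 <= Num.ceil x by rewrite -(ler_int R) (le_trans x0)// ceil_ge.
  by case: (Num.ceil x).
apply: le_trans (ceil_ge x).
have TL := num_levels_le_ln n0.
have T2 : (num_levels n)%:R ^+ 2 <= 144 * ln (n%:R + 1) ^+ 2 :> R.
  apply: (@le_trans _ _ ((12 * ln (n%:R + 1)) ^+ 2)).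
    have l0 : 0 <= ln (n%:R + 1) :> R by lra.
    by rewrite lerXn2r// nnegrE ?mulr_ge0.
  by rewrite exprMn ler_wpM2r ?sqr_ge0//; lra.
have L1 := ln_grid_card_ge1.
apply: (@le_trans _ _ (2 ^+ 29 * n%:R * (144 * ln (n%:R + 1) ^+ 2) *
    (10 * (d%:R * ln (d%:R + 1) * ln M%:R)))).
  rewrite ler_pM ?mulr_ge0 ?sqr_ge0 ?exprn_ge0//; first by lra.
    by rewrite ler_wpM2l// mulr_ge0 ?exprn_ge0.
  exact: ln_grid_card_le.
have -> : 2 ^+ 29 * n%:R * (144 * ln (n%:R + 1) ^+ 2) *
    (10 * (d%:R * ln (d%:R + 1) * ln M%:R)) =
    144 * 10 * (2 ^+ 29 * (n%:R * ln (n%:R + 1) ^+ 2 * (d%:R * ln (d%:R + 1) * ln M%:R))) :> R.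
  by move: (2 ^+ 29) => A; ring.
have -> : x = 2 ^+ 11 * (2 ^+ 29 * (n%:R * ln (n%:R + 1) ^+ 2 * (d%:R * ln (d%:R + 1) * ln M%:R))).
  by rewrite /x -[40%N]/(11 + 29)%N exprD; move: (2 ^+ 29) (2 ^+ 11) => A B; ring.
apply: ler_wpM2r; last by lra.
by rewrite !mulr_ge0 ?exprn_ge0//; lra.
Qed.

End constants.

Section finite_sampling.
Variables (R : realType) (disp : measure_display) (Omega : measurableType disp).
Variables (P : probability Omega R) (G : finType) (m : nat) (U : 'I_m -> Omega -> G).
Hypothesis iidU : iid_uniform P U.

(** A property of the sample is a finite union of the atoms {U = v}, hence measurable, and each atom
    has probability |G|^-m; the complement is bounded by subadditivity. *)
Lemma iid_event (Q : {ffun 'I_m -> G} -> Prop) :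
  ((1 - #|[pred v | ~~ `[< Q v >]]|%:R / #|G|%:R ^+ m)%:E <=
   P [set w | Q [ffun l => U l w]])%E.
Proof.
case: iidU => mU PU indep.
pose C (v : {ffun 'I_m -> G}) := \bigcap_(l in [set` [set: 'I_m]%SET]) U l @^-1` [set v l].
have mC v : measurable (C v).
  apply: fin_bigcap_measurable => [|l _]; last exact: mU.
  exact: finite_finset.
have PC v : P (C v) = (#|G|%:R^-1 ^+ m)%:E.
  rewrite /C (indep [set: 'I_m]%SET (fun l => [set v l])).
  rewrite (eq_bigr (fun=> (#|G|%:R^-1)%:E)); last by move=> l _; exact: PU.
  by rewrite prodEFin prodr_const cardsT card_ord.
have CE v w : C v w <-> [ffun l => U l w] = v.
  split=> [Cw|<- l _]; last by rewrite /= ffunE.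
  by apply/ffunP => l; rewrite ffunE; apply: Cw; rewrite /= inE.
have boole (p : pred {ffun 'I_m -> G}) :
    measurable (\big[setU/set0]_(v | p v) C v) /\
    (P (\big[setU/set0]_(v | p v) C v) <= (#|p|%:R / #|G|%:R ^+ m)%:E)%E.
  split; first exact: bigsetU_measurable.
  have -> : (#|p|%:R / #|G|%:R ^+ m)%:E = (\sum_(v | p v) (#|G|%:R^-1 ^+ m)%:E)%E :> \bar R.
    by rewrite sumEFin sumr_const exprVn mulr_natl.
  rewrite -!(big_filter _ p); elim: [seq v <- _ | p v] => [|v r IH].
    by rewrite !big_nil measure0.
  rewrite !big_cons; apply: le_trans (measureU2 _ _ _) _ => //.
    exact: bigsetU_measurable.
  by apply: leeD IH; rewrite -(PC v).
have inU (p : pred {ffun 'I_m -> G}) w :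
    (\big[setU/set0]_(v | p v) C v) w <-> p [ffun l => U l w].
  have : (\big[setU/set0]_(v | p v) C v) w <->
      exists2 v, p v & v \in index_enum {ffun 'I_m -> G} /\ C v w.
    elim: (index_enum _) => [|v r IH]; first by rewrite big_nil; split=> // -[v _ []].
    rewrite big_cons; case: ifPn => pv.
      split=> [[Cv|/IH[v' pv' [v'r Cv']]]|[v' pv' []]].
      - by exists v => //; split=> //; rewrite mem_head.
      - by exists v' => //; split=> //; rewrite inE v'r orbT.
      - rewrite inE => /predU1P[->|v'r] Cv'; first by left.
        by right; apply/IH; exists v'.
    split=> [/IH[v' pv' [v'r Cv']]|[v' pv' []]].
      by exists v' => //; split=> //; rewrite inE v'r orbT.
    rewrite inE => /predU1P[v'v|v'r Cv']; last by apply/IH; exists v'.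
    by rewrite -v'v pv' in pv.
  move=> ->; split=> [[v pv [_ /CE ->]]//|pU].
  by exists [ffun l => U l w] => //; split; [rewrite mem_index_enum|exact/CE].
have W (p : pred {ffun 'I_m -> G}) :
    [set w | p [ffun l => U l w]] = \big[setU/set0]_(v | p v) C v.
  by apply/seteqP; split=> w /= /inU.
have -> : [set w | Q [ffun l => U l w]] =
    ~` [set w | [pred v | ~~ `[< Q v >]] [ffun l => U l w]].
  by apply/seteqP; split=> w /=; [move=> q; apply/negP/negPn/asboolP|move/negP/negPn/asboolP].
have [mB PB] := boole [pred v | ~~ `[< Q v >]].
rewrite W probability_setC// EFinB leeB//.
Qed.

End finite_sampling.



(** * Reconstruction error for a good sample *)

Section reconstruction.
Variables (R : realType) (d n M m : nat).
Hypotheses (d_gt0 : (0 < d)%N) (n_gt0 : (0 < n)%N) (m_gt0 : (0 < m)%N).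

Let D := ((2 * d + 1) * M)%N.
Notation G := {ffun 'I_d -> 'I_(2 * D + 1)}.

Lemma feasibleP (t : 'I_m -> torus R d) (r : R) y (z : freq d -> R[i]) :
  feasible t (cube d D) r%:E y z <->
  residual (fun l (g : G) => expk (box g) (t l)) y (fun g => z (box g)) <= r.
Proof.
rewrite /feasible lee_fin /residual.
by under eq_bigr do rewrite sum_cube.
Qed.

Lemma l1norm_cube (z : freq d -> R[i]) :
  l1norm (cube d D) z = \sum_(g : G) cabs (z (box g)).
Proof. exact: sum_cube. Qed.

Lemma reconstruction_tpoly xs (y : 'I_m -> R[i]) :
  reconstruction (cube d D) xs y =
  tpoly (@box d D) (fun g => xs y (box g)) :> (torus R d -> R[i]).
Proof. by apply/funext => x; rewrite /reconstruction sum_cube. Qed.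

Lemma l1_minimization_map_exists (t : 'I_m -> torus R d) J eps :
  exists xs, l1_minimization_map t J eps xs.
Proof.
have /choice[xs xsP] : forall y, exists z : freq d -> R[i],
    ((exists z', l1_minimizer t J eps y z') -> l1_minimizer t J eps y z) /\
    (~ (exists z', l1_minimizer t J eps y z') -> forall k, J k -> z k = 0).
  move=> y; have [[z zP]|no] := pselect (exists z, l1_minimizer t J eps y z).
    by exists z; split=> // /(_ (ex_intro _ z zP)).
  by exists (fun=> 0); split.
by exists xs.
Qed.

(** Extension by zero: the sum has one term on the cube, by injectivity of [box], and none
    elsewhere. *)
Definition extend (z : G -> R[i]) (k : freq d) : R[i] :=
  \sum_(g | box g == k) z g.

Lemma extendE z g : extend z (box g) = z g.
Proof.
rewrite /extend (eq_bigl (pred1 g)) ?big_pred1_eq// => h.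
by rewrite /= (inj_eq (@box_inj d D)).
Qed.

Variable v : {ffun 'I_m -> G}.
Hypothesis good : good_sample (@grid_exp R d D) n (num_levels n) v.

Let t l := grid_point R (v l).

Lemma grid_card_gt0 : (0 < #|{: G}|)%N.
Proof. by rewrite card_ffun !card_ord expn_gt0 addn1. Qed.

Lemma good_eigenvalue (h : G -> R[i]) :
  (\sum_g cabs (h g)) ^+ 2 <= 4 * n%:R * \sum_g cabs (h g) ^+ 2 ->
  \sum_g cabs (h g) ^+ 2 <=
    2 ^+ 9 * (m%:R^-1 * \sum_l cabs (synthesis (@grid_exp R d D) h (v l)) ^+ 2).
Proof.
have e1 j x : cabs (@grid_exp R d D j x) <= 1 by rewrite cabs_expk.
have T3 : (3 <= num_levels n)%N by rewrite /num_levels (leq_trans _ (leq_addl _ _)).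
exact: (good_sample_eigenvalue e1 grid_card_gt0 (@grid_parseval R d D)
  n_gt0 T3 m_gt0 (num_levels_pow n) good).
Qed.

Variable F : quasiNormedSpace R (torus R d).
Hypothesis embF : embeds_in_Linfty F.

Lemma residual_le (y : 'I_m -> R[i]) (z : G -> R[i]) (r : R) : 0 <= r ->
  (forall l, cabs (tpoly (@box d D) z (t l) - y l) <= r) ->
  residual (fun l (g : G) => expk (box g) (t l)) y z <= r * Num.sqrt m%:R.
Proof.
move=> r0 zy; rewrite -[X in X * _]ger0_norm// -sqrtr_sqr -sqrtrM ?sqr_ge0//.
rewrite ler_wsqrtr// mulr_natr -[m in _ *+ m]card_ord -sumr_const.
apply: ler_sum => l _; rewrite lerXn2r// ?nnegrE ?cabs_ge0//.
apply: le_trans (zy l); rewrite /tpoly.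
by under eq_bigr do rewrite mulrC.
Qed.

Lemma reconstruction_error xs (f : torus R d -> R[i]) :
  l1_minimization_map t (cube d D)
    (noise_level n M F * (Num.sqrt m%:R)%:E)%E xs ->
  unit_ball F f ->
  (L2norm (fun x => f x - reconstruction (cube d D) xs (samples t f) x)%R <=
   (2 ^+ 10)%:E * (best_nterm n F + best_approx (cube d M) F))%E.
Proof.
move=> xsP Ff; have Lf := embF.1 _ Ff.1.
have p10 : 0 < 2 ^+ 10 :> R by rewrite exprn_gt0.
have s0 := best_nterm_ge0 n F; have t0 := best_approx_ge0 F (cube d M).
have /andP[tau0 tau1] := vp_norm_bounds R M d_gt0.
move: s0 t0 tau0 tau1.
(* If either quantity is infinite, so is the right-hand side; from then on eta is a real number. *)
case sE : (best_nterm n F) => [s| |] //; last first.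
  by move=> _ t0 _ _; rewrite addye ?gt0_muley ?lte_fin ?leey// -ltNye (lt_le_trans _ t0).
case tE : (best_approx (cube d M) F) => [b| |] //; last first.
  by move=> _ _ _ _; rewrite addey// gt0_muley ?lte_fin ?leey.
case tauE : (vp_norm R d M) => [tau| |] //.
rewrite !lee_fin => s0 b0 tau0 tau1.
pose eta := tau * s + (1 + tau) * b.
have nE : noise_level n M F = eta%:E by rewrite /noise_level sE tE tauE.
rewrite nE -EFinM in xsP.
have eta0 : 0 <= eta by rewrite addr_ge0 ?mulr_ge0 ?addr_ge0.
(* Since tau <= 5/2, both tau and 1 + tau are at most 4. *)
have eta_le : 2 ^+ 8 * eta <= 2 ^+ 10 * (s + b).
  rewrite (_ : 2 ^+ 10 = 2 ^+ 8 * 4); last by ring.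
  rewrite -mulrA ler_pM2l ?exprn_gt0// /eta.
  have : 0 <= (5 / 2 - tau) * s by rewrite mulr_ge0// subr_ge0.
  have : 0 <= (5 / 2 - tau) * b by rewrite mulr_ge0// subr_ge0.
  lra.
have approx delta : 0 < delta -> exists S : {set G}, exists z : G -> R[i],
    [/\ (#|S| <= n)%N, forall g, g \notin S -> z g = 0 &
      forall x, cabs (f x - tpoly (@box d D) z x) <= eta + delta].
  move=> d0; have k0 : 0 < 1 + 2 * tau by lra.
  have dk : 0 < delta / (1 + 2 * tau) by rewrite divr_gt0.
  have [S [z [h1 h2 h3]]] := sparse_approximant d_gt0 sE tE tauE embF Ff dk.
  exists S, z; split=> // x; apply: le_trans (h3 x) _.
  by rewrite -/eta lerD2l mulrC divfK ?lt0r_neq0.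
have [B fB] := Lf.2.
have B0 : 0 <= B by exact: le_trans (cabs_ge0 _) (fB (t (Ordinal m_gt0))).
have sm0 : 0 < Num.sqrt m%:R :> R by rewrite sqrtr_gt0 ltr0n.
pose E := fun (l : 'I_m) (g : G) => expk (box g) (t l) : R[i].
have res_approx (z : G -> R[i]) (e : R) : 0 <= e ->
    (forall x, cabs (f x - tpoly (@box d D) z x) <= e) ->
    residual E (samples t f) z <= e * Num.sqrt m%:R.
  by move=> e0 fz; apply: residual_le => // l; rewrite cabsB; exact: fz.
have [S [z [Sn zS rz]]] : exists S : {set G}, exists z : G -> R[i],
    [/\ (#|S| <= n)%N, forall g, g \notin S -> z g = 0 &
      residual E (samples t f) z <= eta * Num.sqrt m%:R].
  (* A uniform bound for the coefficients: they are Fourier coefficients of a polynomial within eta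
     + 1 of f, itself bounded by B. This is why delta is capped at 1 below. *)
  have BB : 0 <= B + (eta + 1) by rewrite addr_ge0// addr_ge0.
  apply: (sparse_exact BB).
  move=> delta delta0.
  have d1 : 0 < Num.min 1 (delta / Num.sqrt m%:R) by rewrite lt_min ltr01 divr_gt0.
  have [S [z [h1 h2 h3]]] := approx _ d1.
  exists S, z; split=> // [g|].
    rewrite -(fourier_tpoly (@box_inj d D) z g).
    apply: cabs_fourier_le; first exact: Linfty_tpoly.
    move=> x; have := cabsD (tpoly (@box d D) z x - f x) (f x).
    rewrite subrK => /le_trans; apply; rewrite addrC lerD// cabsB.
    by apply: le_trans (h3 x) _; rewrite lerD2l ge_min lexx.
  apply: le_trans (res_approx _ _ _ h3) _.
    by rewrite addr_ge0// ltW.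
  rewrite mulrDl lerD2l -ler_pdivlMr//.
  by rewrite ge_min lexx orbT.
(* A feasible vector exists, so the minimum is attained and the default value zero of [xs] does not
   occur. *)
have xmin : l1_minimizer t (cube d D) (eta * Num.sqrt m%:R)%:E (samples t f)
    (xs (samples t f)).
  apply: (xsP (samples t f)).1.
  have [w rw wmin] := l1_minimizer_exists rz.
  have wE : (fun g => extend w (box g)) = w by apply/funext => g; exact: extendE.
  exists (extend w); split; first by apply/feasibleP; rewrite wE.
  move=> z' /feasibleP rz'; rewrite !l1norm_cube.
  have := wmin _ rz'; congr (_ <= _).
  by apply: eq_bigr => g _; rewrite extendE.
have [/feasibleP rx xz] := xmin.
set x := fun g : G => xs (samples t f) (box g) in rx.
have {}xz : \sum_g cabs (x g) <= \sum_g cabs (z g).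
  have := xz (extend z); rewrite !l1norm_cube.
  have zE : (fun g : G => extend z (box g)) = z by apply/funext => g; exact: extendE.
  have -> : \sum_(g : G) cabs (extend z (box g)) = \sum_g cabs (z g).
    by apply: eq_bigr => g _; rewrite extendE.
  by apply; apply/feasibleP; rewrite zE.
apply/lee_addgt0Pr => eps eps0; rewrite -EFinD.
pose delta := eps / 2 ^+ 8.
have delta0 : 0 < delta by rewrite divr_gt0// exprn_gt0.
have [S' [z' [S'n z'S fz']]] := approx delta delta0.
have eta'0 : 0 <= eta + delta by rewrite addr_ge0// ltW.
have rz' := res_approx _ _ eta'0 fz'.
have rec : \sum_g cabs (z' g - x g) ^+ 2 <= 2 ^+ 13 * (eta + delta) ^+ 2.
  apply: (@l1_recovery _ _ _ (@grid_exp R d D) m n v m_gt0 good_eigenvalue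
    (samples t f) x z z' S S' eta) => //.
  by rewrite eta0 lerDl ltW.
rewrite reconstruction_tpoly -/x.
apply: (@le_trans _ _ (2 ^+ 8 * (eta + delta))%:E); last first.
  by rewrite lee_fin mulrDr lerD// /delta mulrC divfK// expf_neq0.
have Lz' := Linfty_tpoly (@box d D) z'; have Lx := Linfty_tpoly (@box d D) x.
apply: L2norm_le; [exact: LinftyB|by rewrite mulr_ge0 ?exprn_ge0|].
have tpB y : tpoly (@box d D) (fun g => z' g - x g) y =
    tpoly (@box d D) z' y - tpoly (@box d D) x y.
  by rewrite /tpoly -sumrB; apply: eq_bigr => g _; rewrite mulrBl.
(* f minus the reconstruction splits at the polynomial of z': the first part is uniformly small on
   the torus, the second is a polynomial handled by Parseval. *)
apply: (@le_trans _ _ (\int[haar R d]_y (2 * (eta + delta) ^+ 2 +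
    2 * cabs (tpoly (@box d D) (fun g => z' g - x g) y) ^+ 2))).
  apply: le_Rintegral => //.
  - apply: bounded_measurable_integrable; apply: bounded_measurable_cabs2.
    exact: LinftyB.
  - apply: bounded_measurable_integrable; apply: bounded_measurableD.
      exact: bounded_measurable_cst.
    apply: (bounded_measurableM (bounded_measurable_cst _ 2)).
    by apply: bounded_measurable_cabs2; exact: Linfty_tpoly.
  move=> y _; rewrite tpB.
  have -> : f y - tpoly (@box d D) x y = (f y - tpoly (@box d D) z' y) -
    (- (tpoly (@box d D) z' y - tpoly (@box d D) x y)) by ring.
  apply: le_trans (sqr_cabsB _ _) _; rewrite cabsN lerD2r ler_pM2l//.
  by rewrite lerXn2r ?nnegrE ?cabs_ge0.
have bz : bounded_measurable (fun y =>
    cabs (tpoly (@box d D) (fun g => z' g - x g) y : R[i]) ^+ 2).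
  by apply: bounded_measurable_cabs2; exact: Linfty_tpoly.
rewrite RintegralD//; last 2 first.
- by apply: bounded_measurable_integrable; exact: bounded_measurable_cst.
- apply: bounded_measurable_integrable.
  exact: (bounded_measurableM (bounded_measurable_cst _ 2) bz).
rewrite Rintegral_probability_cst RintegralZl//; last exact: bounded_measurable_integrable.
rewrite parseval; last exact: box_inj.
(* The squared error is at most (2 + 2 * 2^13)(eta + delta)^2, which is below 2^16 (eta +
   delta)^2. *)
rewrite exprMn -exprM (_ : 2 ^+ (8 * 2) = 2 ^+ 13 * 8); last by rewrite -[(8 * 2)%N]/(13 + 3)%N exprD; ring.
have p13 : 1 <= 2 ^+ 13 :> R by rewrite exprn_ege1// ler1n.
have := sqr_ge0 (eta + delta); move: rec p13; move: (2 ^+ 13) ((eta + delta) ^+ 2) => A Q.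
move=> h A1 Q0; have : 0 <= (A - 1) * Q by rewrite mulr_ge0// subr_ge0.
lra.
Qed.

End reconstruction.



(** * Proportion of bad samples for the prescribed m *)

Section bad_samples.
Variables (R : realType) (d n M : nat).
Hypotheses (d_gt0 : (0 < d)%N) (n_gt0 : (0 < n)%N) (M_ge3 : (3 <= M)%N).

Let D := ((2 * d + 1) * M)%N.
Notation G := {ffun 'I_d -> 'I_(2 * D + 1)}.
Let m := `|Num.ceil (2 ^+ 40 * d%:R * ln (d%:R + 1) * n%:R *
  ln (n%:R + 1) ^+ 2 * ln M%:R : R)|%N.
Let N := ((2 * (2 * d + 1) * M + 1) ^ d)%N.

Let cardG : #|{: G}| = N.
Proof. by rewrite card_ffun !card_ord /N /D mulnA. Qed.

Lemma sample_size_gt0 : (0 < m)%N.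
Proof.
have := sample_size_le R d_gt0 M_ge3 n_gt0; rewrite -/m => h.
rewrite -(ltr0n R); apply: lt_le_trans h.
have L1 := ln_grid_card_ge1 R d_gt0 M_ge3.
rewrite mulr_gt0//; last exact: lt_le_trans L1.
by rewrite !mulr_gt0 ?exprn_gt0 ?ltr0n// /num_levels addnS.
Qed.

(** Counting gives exp(- T ln N), and T >= ln(n+1); hence gamma = 1. *)
Lemma bad_sample_bound :
  #|[pred v : {ffun 'I_m -> G} |
      ~~ `[< good_sample (@grid_exp R d D) n (num_levels n) v >]]|%:R /
    #|{: G}|%:R ^+ m <= N%:R `^ (- (1 * ln (n%:R + 1))) :> R.
Proof.
have G0 : 0 < #|{: G}|%:R :> R by rewrite ltr0n; exact: grid_card_gt0.
rewrite ler_pdivrMr ?exprn_gt0//.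
have T3 : (3 <= num_levels n)%N by rewrite /num_levels (leq_trans _ (leq_addl _ _)).
have L1 := ln_grid_card_ge1 R d_gt0 M_ge3.
have NE : ((2 * ((2 * d + 1) * M) + 1) ^ d)%N = N by rewrite /N mulnA.
have h := @card_bad_sample R _ _ (@grid_exp R d D) (grid_card_gt0 d M) n (num_levels n) m (ln N%:R) n_gt0 T3.
rewrite NE in L1; apply: le_trans (h L1 _ _) _.
- by rewrite cardG; have := grid_dictionary_le R d_gt0 M_ge3; rewrite NE.
- by have := sample_size_le R d_gt0 M_ge3 n_gt0; rewrite NE.
rewrite ler_wpM2r ?exprn_ge0//.
rewrite /powR; case: ifPn => [/eqP N0|_].
  by move: L1; rewrite N0 ln0 ?ler10.
rewrite ler_expR mul1r mulNr lerN2 ler_wpM2r ?ln_le_num_levels//.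
exact: le_trans L1.
Qed.

Lemma bad_sample_lt1 : N%:R `^ (- (1 * ln (n%:R + 1))) < 1 :> R.
Proof.
have NE : ((2 * ((2 * d + 1) * M) + 1) ^ d)%N = N by rewrite /N mulnA.
have L1 := ln_grid_card_ge1 R d_gt0 M_ge3; rewrite NE in L1.
rewrite /powR; case: ifPn => [/eqP N0|_].
  by move: L1; rewrite N0 ln0 ?ler10.
rewrite -[ltRHS]expR0 ltr_expR mul1r mulNr oppr_lt0 mulr_gt0//; last exact: lt_le_trans L1.
by apply: lt_le_trans (ln_succ_ge_half R n_gt0); rewrite invr_gt0.
Qed.

End bad_samples.

Theorem theorem3p2 (R : realType) :
  exists C Ct gamma : R, [/\ 0 < C, 0 < Ct, 0 < gamma &
    forall (d n M : nat) (F : quasiNormedSpace R (torus R d)),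
      (1 <= d)%N -> (1 <= n)%N -> (3 <= M)%N -> embeds_in_Linfty F ->
      let m := `|Num.ceil (C * d%:R * ln (d%:R + 1) * n%:R *
                           ln (n%:R + 1) ^+ 2 * ln M%:R)|%N in
      let N := ((2 * (2 * d + 1) * M + 1) ^ d)%N in
      let D := ((2 * d + 1) * M)%N in
      let Jstar := cube d D in
      let eta := noise_level n M F in
      let err := (Ct%:E * (best_nterm n F + best_approx (cube d M) F))%E in
      (sampling_number m F <= err)%E /\
      forall (disp : measure_display) (Omega : measurableType disp)
             (P : probability Omega R)
             (U : 'I_m -> Omega -> {ffun 'I_d -> 'I_(2 * D + 1)}),
        iid_uniform P U ->
        let u := fun (w : Omega) (l : 'I_m) => grid_point R (U l w) in
        forall xsharp : ('I_m -> torus R d) -> ('I_m -> R[i]) -> freq d -> R[i],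
          (forall v : 'I_m -> torus R d,
             l1_minimization_map v Jstar (eta * (Num.sqrt m%:R)%:E)%E
               (xsharp v)) ->
          ((1 - N%:R `^ (- (gamma * ln (n%:R + 1))))%:E <=
           P [set w | forall f, unit_ball F f ->
             (L2norm (fun x => f x -
                reconstruction Jstar (xsharp (u w)) (samples (u w) f) x)%R
              <= err)%E])%E].
Proof.
exists (2 ^+ 40), (2 ^+ 10), 1; split; rewrite ?exprn_gt0//.
move=> d n M F d1 n1 M3 embF m N D Jstar eta err.
have m0 : (0 < m)%N := sample_size_gt0 R d1 n1 M3.
have bad := bad_sample_bound R d1 n1 M3.
have lt1 := bad_sample_lt1 R d1 n1 M3.
split.
  (* Probabilistic method: if no sample were good, the bad proportion would be 1, against the strict
     bound [lt1]. *)
  have [v good] : exists v : {ffun 'I_m -> {ffun 'I_d -> 'I_(2 * D + 1)}},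
      good_sample (@grid_exp R d D) n (num_levels n) v.
    apply/not_existsP => no; move: (le_lt_trans bad lt1).
    rewrite (eq_card (B := predT)); last first.
      by move=> v; rewrite !inE; apply/asboolP/no.
    have G0 : 0 < #|{: {ffun 'I_d -> 'I_(2 * D + 1)}}|%:R :> R.
      by rewrite ltr0n; exact: grid_card_gt0.
    by rewrite card_ffun card_ord natrX divff ?ltxx// expf_neq0 ?lt0r_neq0.
  pose t l := grid_point R (v l).
  have [xs xsP] := l1_minimization_map_exists t Jstar (eta * (Num.sqrt m%:R)%:E)%E.
  apply: (@le_trans _ _ (ereal_sup [set L2norm (fun x =>
      f x - reconstruction Jstar xs (samples t f) x) | f in unit_ball F])).
    apply: ereal_inf_lbound; exists t => //; exists (reconstruction Jstar xs) => // y.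
    (* Admissibility in the sampling number: each output is a trigonometric polynomial, hence
       bounded and in L^2. *)
    have := Linfty_tpoly (@box d D) (fun g => xs y (box g)).
    rewrite -reconstruction_tpoly => Lrec; have [mrec [B rB]] := Lrec; split=> //.
    have B0 : 0 <= B by exact: le_trans (cabs_ge0 _) (rB (t (Ordinal m0))).
    apply: le_lt_trans (ltry B); apply: L2norm_le => //.
    rewrite -[leRHS](Rintegral_probability_cst (haar R d)).
    apply: le_Rintegral => //.
    - by apply: bounded_measurable_integrable; exact: bounded_measurable_cabs2.
    - by apply: bounded_measurable_integrable; exact: bounded_measurable_cst.
    - by move=> x _; rewrite lerXn2r ?nnegrE ?cabs_ge0.
  apply: ge_ereal_sup => _ [f Ff <-].
  exact: (reconstruction_error d1 n1 m0 good embF xsP Ff).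
move=> disp Omega P U iidU u xsharp xsP.
pose Q (v : {ffun 'I_m -> {ffun 'I_d -> 'I_(2 * D + 1)}}) : Prop :=
  let t l := grid_point R (v l) in
  forall f, unit_ball F f -> (L2norm (fun x => f x -
    reconstruction Jstar (xsharp t) (samples t f) x)%R <= err)%E.
have -> : [set w | forall f, unit_ball F f -> (L2norm (fun x => f x -
      reconstruction Jstar (xsharp (u w)) (samples (u w) f) x)%R <= err)%E] =
    [set w | Q [ffun l => U l w]].
  have uE w : (fun l => grid_point R ([ffun l => U l w] l)) = u w.
    by apply/funext => l; rewrite ffunE.
  by apply/funext => w; rewrite /Q/= uE.
apply: le_trans (iid_event iidU Q); rewrite lee_fin lerD2l lerN2.
apply: le_trans bad; rewrite ler_pM2r; last first.
  by rewrite invr_gt0 exprn_gt0// ltr0n; exact: grid_card_gt0.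
(* Every good sample satisfies [Q], so the samples violating [Q] are among the bad ones. *)
rewrite ler_nat; apply: subset_leq_card; apply/fintype.subsetP => v; rewrite !inE.
apply: contra => /asboolP good; apply/asboolP => t f Ff.
exact: (reconstruction_error d1 n1 m0 good embF (xsP t) Ff).
Qed.
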